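(* Let $n\ge5$ and fix $\sigma_0\in(1,2)$ and $\theta\in(0,\bar\theta)$. Then there exists a concave, increasing function $f:[0,\infty)\to[0,\infty)$ such that $f(s)=\frac{s}{n-2\sigma_0}$ for all sufficiently small $s\ge 0$, $\lim_{s\to\infty}\frac{f(s)}{s}=\frac{1}{n-2}$, and the set $$\{R=S+H\odot\mathrm{id}:\ S\in PIC2,\ \mathrm{Ric}_0(S)=0,\ f(\mathrm{tr}(H))\,\mathrm{id}-H\ge0,\ \mathrm{tr}(H)-\theta\,\mathrm{scal}(S)\ge0\}$$ is invariant under the Hamilton ODE.
   Context: An algebraic curvature tensor on $\mathbb{R}^n$ is a tensor $R=(R_{ijkl})$ with $R_{ijkl}=-R_{jikl}=R_{klij}$ and $R_{ijkl}+R_{jkil}+R_{kijl}=0$; the unit round sphere has $R_{ijkl}=\delta_{ik}\delta_{jl}-\delta_{il}\delta_{jk}$. We write $\mathrm{Ric}(R)_{ik}=\sum_j R_{ijkj}$, $\mathrm{scal}(R)=\sum_i\mathrm{Ric}(R)_{ii}$, $\mathrm{Ric}_0(R)=\mathrm{Ric}(R)-\frac1n\mathrm{scal}(R)\,\mathrm{id}$. For symmetric bilinear forms $A,B$, $(A\odot B)_{ijkl}=A_{ik}B_{jl}-A_{il}B_{jk}-A_{jk}B_{il}+A_{jl}B_{ik}$; $\mathrm{id}=(\delta_{ij})$. The PIC2 cone is the set of algebraic curvature tensors $R$ with $R(z,w,\bar z,\bar w)\ge0$ for all $z,w\in\mathbb{C}^n$ ($R$ extended complex-multilinearly). In the set,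 $S$ ranges over algebraic curvature tensors, $H$ over symmetric bilinear forms, and ''$\ge0$'' means positive semidefinite. For algebraic curvature tensors $S,T$ let $B(S,T)_{ijkl}=\frac12\sum_{p,q}(S_{ijpq}T_{klpq}+S_{klpq}T_{ijpq})+\sum_{p,q}(S_{ipkq}T_{jplq}-S_{iplq}T_{jpkq}-S_{jpkq}T_{iplq}+S_{jplq}T_{ipkq})$ and $Q(R)=B(R,R)$. The Hamilton ODE is $\frac{d}{dt}R=Q(R)$; a set $F$ is invariant under it if every solution with $R(0)\in F$ satisfies $R(t)\in F$ for all $t\ge0$ in its interval of existence. For $\sigma\in(0,2]$, $\theta\ge0$, $\mathcal{C}_{\sigma,\theta}$ is the set of $R=S+H\odot\mathrm{id}$ with $S\in PIC2$, $\mathrm{Ric}_0(S)=0$, $\mathrm{tr}(H)\,\mathrm{id}-(n-2\sigma)H\ge0$, $\mathrm{tr}(H)-\theta\,\mathrm{scal}(S)\ge0$. $\bar\theta=\bar\theta(n)>0$ denotes a constant such that for all $\sigma\in(0,2]$, $\theta\in[0,\bar\theta]$ the cone $\mathcal C_{\sigma,\theta}$ is invariant under the Hamilton ODE, and for $\sigma\in(0,1)\cup(1,2)$, $\theta\in(0,\bar\theta)$ it is transversally invariant away from $0$, i.e. for every $R\in\partial\mathcal C_{\sigma,\theta}\setminus\{0\}$, $Q(R)$ lies in the interior of the tangent cone of $\mathcal C_{\sigma,\theta}$ at $R$ (such a constant exists). *)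

(* Defs.v *)
From Stdlib Require Import Reals Lra.
Open Scope R_scope.

(* Tensors on R^n are represented as functions of nat indices; only the
   values at indices < n are ever inspected. *)
Definition tensor4 := nat -> nat -> nat -> nat -> R.
Definition bilin := nat -> nat -> R.
Definition tset := tensor4 -> Prop.

Fixpoint rsum (n : nat) (f : nat -> R) : R :=
  match n with O => 0 | S k => rsum k f + f k end.

Definition forall4 (n : nat) (P : nat -> nat -> nat -> nat -> Prop) : Prop :=
  forall i j k l, (i < n)%nat -> (j < n)%nat -> (k < n)%nat -> (l < n)%nat ->
    P i j k l.

Definition sum4 (n : nat) (f : nat -> nat -> nat -> nat -> R) : R :=
  rsum n (fun i => rsum n (fun j => rsum n (fun k => rsum n (fun l => f i j k l)))).

Definition is_act (n : nat) (T : tensor4) : Prop :=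
  forall4 n (fun i j k l =>
    T i j k l = - T j i k l /\ T i j k l = T k l i j /\
    T i j k l + T j k i l + T k i j l = 0).

Definition delta (i j : nat) : R := if Nat.eqb i j then 1 else 0.
Definition id_form : bilin := delta.

Definition is_sym (n : nat) (H : bilin) : Prop :=
  forall i j, (i < n)%nat -> (j < n)%nat -> H i j = H j i.

Definition ric (n : nat) (T : tensor4) : bilin :=
  fun i k => rsum n (fun j => T i j k j).
Definition scal (n : nat) (T : tensor4) : R := rsum n (fun i => ric n T i i).
Definition trace (n : nat) (H : bilin) : R := rsum n (fun i => H i i).
Definition ric0 (n : nat) (T : tensor4) : bilin :=
  fun i k => ric n T i k - / INR n * scal n T * delta i k.

Definition odot (A B : bilin) : tensor4 :=
  fun i j k l => A i k * B j l - A i l * B j k - A j k * B i l + A j l * B i k.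

Definition psd (n : nat) (M : bilin) : Prop :=
  forall x : nat -> R, 0 <= rsum n (fun i => rsum n (fun k => x i * M i k * x k)).

Definition cplx := (R * R)%type.
Definition cmul (a b : cplx) : cplx :=
  (fst a * fst b - snd a * snd b, fst a * snd b + snd a * fst b).
Definition cconj (a : cplx) : cplx := (fst a, - snd a).
Definition cscale (r : R) (a : cplx) : cplx := (r * fst a, r * snd a).
Definition cadd (a b : cplx) : cplx := (fst a + fst b, snd a + snd b).
Fixpoint csum (n : nat) (f : nat -> cplx) : cplx :=
  match n with O => (0, 0) | S k => cadd (csum k f) (f k) end.

Definition curv_c (n : nat) (T : tensor4) (z w u v : nat -> cplx) : cplx :=
  csum n (fun i => csum n (fun j => csum n (fun k => csum n (fun l =>
    cscale (T i j k l) (cmul (cmul (z i) (w j)) (cmul (u k) (v l))))))).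

Definition pic2 (n : nat) (T : tensor4) : Prop :=
  forall z w : nat -> cplx,
    let c := curv_c n T z w (fun i => cconj (z i)) (fun i => cconj (w i)) in
    snd c = 0 /\ 0 <= fst c.

Definition bform (n : nat) (S T : tensor4) : tensor4 := fun i j k l =>
  / 2 * rsum n (fun p => rsum n (fun q => S i j p q * T k l p q + S k l p q * T i j p q))
  + rsum n (fun p => rsum n (fun q =>
      S i p k q * T j p l q - S i p l q * T j p k q
      - S j p k q * T i p l q + S j p l q * T i p k q)).
Definition Qc (n : nat) (T : tensor4) : tensor4 := bform n T T.

Definition is_solution (n : nat) (a b : R) (Rt : R -> tensor4) : Prop :=
  forall t, a < t < b ->
    forall4 n (fun i j k l =>
      derivable_pt_lim (fun s => Rt s i j k l) t (Qc n (Rt t) i j k l)).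

Definition ode_invariant (n : nat) (F : tset) : Prop :=
  forall (a b : R) (Rt : R -> tensor4), a < 0 < b -> is_solution n a b Rt ->
    F (Rt 0) -> forall t, 0 <= t < b -> F (Rt t).

Definition cone_C (n : nat) (sigma theta : R) : tset := fun T =>
  exists (S : tensor4) (H : bilin),
    is_act n S /\ is_sym n H /\
    forall4 n (fun i j k l => T i j k l = S i j k l + odot H id_form i j k l) /\
    pic2 n S /\
    (forall i k, (i < n)%nat -> (k < n)%nat -> ric0 n S i k = 0) /\
    psd n (fun i k => trace n H * delta i k - (INR n - 2 * sigma) * H i k) /\
    0 <= trace n H - theta * scal n S.

Definition tdist2 (n : nat) (V W : tensor4) : R :=
  sum4 n (fun i j k l => (V i j k l - W i j k l) ^ 2).
Definition in_closure (n : nat) (K : tset) (V : tensor4) : Prop :=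
  forall eps, 0 < eps -> exists W, K W /\ tdist2 n V W < eps.
Definition in_interior (n : nat) (K : tset) (V : tensor4) : Prop :=
  exists eps, 0 < eps /\ forall W, is_act n W -> tdist2 n V W < eps -> K W.
Definition in_boundary (n : nat) (K : tset) (V : tensor4) : Prop :=
  in_closure n K V /\ ~ in_interior n K V.
Definition nonzero (n : nat) (V : tensor4) : Prop :=
  exists i j k l, (i < n)%nat /\ (j < n)%nat /\ (k < n)%nat /\ (l < n)%nat /\
    V i j k l <> 0.

Definition tangent_cone (n : nat) (C : tset) (R0 : tensor4) : tset :=
  in_closure n (fun V => exists (t : R) (X : tensor4), 0 <= t /\ C X /\
    forall4 n (fun i j k l => V i j k l = t * (X i j k l - R0 i j k l))).

Definition transversally_invariant_away0 (n : nat) (C : tset) : Prop :=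
  forall T, is_act n T -> in_boundary n C T -> nonzero n T ->
    in_interior n (tangent_cone n C T) (Qc n T).

Definition is_theta_bar (n : nat) (tb : R) : Prop :=
  0 < tb /\
  (forall sigma theta, 0 < sigma <= 2 -> 0 <= theta <= tb ->
      ode_invariant n (cone_C n sigma theta)) /\
  (forall sigma theta, (0 < sigma < 1 \/ 1 < sigma < 2) -> 0 < theta < tb ->
      transversally_invariant_away0 n (cone_C n sigma theta)).

Definition set_f (n : nat) (f : R -> R) (theta : R) : tset := fun T =>
  exists (S : tensor4) (H : bilin),
    is_act n S /\ is_sym n H /\
    forall4 n (fun i j k l => T i j k l = S i j k l + odot H id_form i j k l) /\
    pic2 n S /\
    (forall i k, (i < n)%nat -> (k < n)%nat -> ric0 n S i k = 0) /\
    psd n (fun i k => f (trace n H) * delta i k - H i k) /\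
    0 <= trace n H - theta * scal n S.

(* Main.v *)
Require Import Defs.
From Stdlib Require Import Reals Lra Lia Classical ClassicalEpsilon.
From Coquelicot Require Compactness.
Open Scope R_scope.

(** Write b = 1/(n - 2 sigma), so that the cone of parameter sigma is given by H <= b tr(H) id.
    Transversality at T says that Q(T) + t T - e P lies in the cone for some t >= 0, e > 0, where
    P is a multiple of id (.) id interior to all the cones. This condition is open in T and b and
    homogeneous, so by compactness it holds with t = |T|/d, e = d |T|^2 and d = d(b) > 0
    nondecreasing in b on (1/(n-2), 1/(n-2 sigma_0)]. Along the flow the pinching constant b
    thus improves at a rate at least of order d(b)^2 (b - 1/(n-2)) relative to the growth of
    tr(H), and a function f for which f(s)/s decreases more slowly than that in log s gives an
    invariant set; such an f is the lower envelope of lines with rapidly growing intercepts.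
    Invariance follows by finitely many Euler steps of uniform length: the error of one step is
    absorbed by the gain e P, the condition involving theta comes for free from the invariance
    of the cone of parameter sigma_0, and for small curvature the set agrees with that cone. *)

(** * Finite sums *)

(** Transversality is assumed for sigma in (1,2) but not at sigma = 1, that is at slope 1/(n-2), so
    d(b) may tend to 0 there at an uncontrolled rate. This is why [f] cannot be written down in
    advance: its intercepts are built from d, and its lines all have slopes above 1/(n-2). A second
    obstacle is that S + H (.) id is not a unique decomposition, since multiples of id (.) id can
    move between S and H, so tr(H) is not a function of R. No canonical decomposition is chosen.
    Decompositions are added instead, and tr(H), the upper bound of H and the theta condition add up
    with them. An Euler step becomes a sum (1 - r) T + tau X + (ep P + E) of decomposed tensors, X
    being the transversal direction and E the error. The last summand does double duty: even with E
    included it has slope 1/(n-2), because H = id alone needs only slope 1/n, and the gain in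
    pinching is proportional to b - 1/(n-2). As the error is absorbed completely, each step lands in
    the set itself, and finitely many steps reach a given time without a limit. *)

Lemma Rabs_le_inv (x c : R) : Rabs x <= c -> - c <= x <= c.
Proof. unfold Rabs; destruct (Rcase_abs x); lra. Qed.

Lemma rsum_ext (n : nat) (f g : nat -> R) :
  (forall i, (i < n)%nat -> f i = g i) -> rsum n f = rsum n g.
Proof.
  induction n as [|n IH]; intros H; [easy|]; simpl.
  rewrite IH, H; auto with arith.
Qed.

Lemma rsum_plus (n : nat) (f g : nat -> R) :
  rsum n (fun i => f i + g i) = rsum n f + rsum n g.
Proof. induction n as [|n IH]; simpl; [lra|]. rewrite IH; lra. Qed.

Lemma rsum_scal_l (n : nat) (c : R) (f : nat -> R) :
  rsum n (fun i => c * f i) = c * rsum n f.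
Proof. induction n as [|n IH]; simpl; [lra|]. rewrite IH; lra. Qed.

Lemma rsum_scal_r (n : nat) (c : R) (f : nat -> R) :
  rsum n (fun i => f i * c) = rsum n f * c.
Proof. induction n as [|n IH]; simpl; [lra|]. rewrite IH; lra. Qed.

Lemma rsum_opp (n : nat) (f : nat -> R) :
  rsum n (fun i => - f i) = - rsum n f.
Proof. induction n as [|n IH]; simpl; [lra|]. rewrite IH; lra. Qed.

Lemma rsum_minus (n : nat) (f g : nat -> R) :
  rsum n (fun i => f i - g i) = rsum n f - rsum n g.
Proof. induction n as [|n IH]; simpl; [lra|]. rewrite IH; lra. Qed.

Lemma rsum_const (n : nat) (c : R) : rsum n (fun _ => c) = INR n * c.
Proof. induction n as [|n IH]; [simpl; lra|]. rewrite S_INR; simpl; rewrite IH; lra. Qed.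

Lemma rsum_swap (n m : nat) (f : nat -> nat -> R) :
  rsum n (fun i => rsum m (fun j => f i j)) = rsum m (fun j => rsum n (fun i => f i j)).
Proof.
  induction n as [|n IH]; simpl.
  - rewrite rsum_const; lra.
  - rewrite IH, <- rsum_plus; reflexivity.
Qed.

Lemma rsum_le (n : nat) (f g : nat -> R) :
  (forall i, (i < n)%nat -> f i <= g i) -> rsum n f <= rsum n g.
Proof.
  induction n as [|n IH]; intros H; simpl; [lra|].
  apply Rplus_le_compat; auto with arith.
Qed.

Lemma rsum_nonneg (n : nat) (f : nat -> R) :
  (forall i, (i < n)%nat -> 0 <= f i) -> 0 <= rsum n f.
Proof.
  intros H; replace 0 with (rsum n (fun _ => 0)) by (rewrite rsum_const; lra).
  now apply rsum_le.
Qed.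

Lemma rsum_abs (n : nat) (f : nat -> R) : Rabs (rsum n f) <= rsum n (fun i => Rabs (f i)).
Proof.
  induction n as [|n IH]; simpl; [rewrite Rabs_R0; lra|].
  eapply Rle_trans; [apply Rabs_triang|lra].
Qed.

Lemma rsum_abs_le (n : nat) (f : nat -> R) (c : R) :
  (forall i, (i < n)%nat -> Rabs (f i) <= c) -> Rabs (rsum n f) <= INR n * c.
Proof.
  intros H; eapply Rle_trans; [apply rsum_abs|].
  rewrite <- rsum_const; now apply rsum_le.
Qed.

Lemma rsum_term_le (n : nat) (f : nat -> R) (i : nat) :
  (forall j, (j < n)%nat -> 0 <= f j) -> (i < n)%nat -> f i <= rsum n f.
Proof.
  induction n as [|n IH]; intros H Hi; [lia|]; simpl.
  assert (0 <= f n) by auto with arith.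
  destruct (Nat.eq_dec i n) as [->|].
  - assert (0 <= rsum n f) by (apply rsum_nonneg; auto with arith); lra.
  - assert (f i <= rsum n f) by (apply IH; [auto with arith|lia]); lra.
Qed.

Lemma delta_refl (i : nat) : delta i i = 1.
Proof. unfold delta; now rewrite Nat.eqb_refl. Qed.

Lemma delta_neq (i j : nat) : i <> j -> delta i j = 0.
Proof. intros H; unfold delta; now apply Nat.eqb_neq in H as ->. Qed.

Lemma delta_sym (i j : nat) : delta i j = delta j i.
Proof. unfold delta; now rewrite Nat.eqb_sym. Qed.

Lemma rsum_delta_r (n : nat) (f : nat -> R) (k : nat) :
  (k < n)%nat -> rsum n (fun j => f j * delta j k) = f k.
Proof.
  induction n as [|n IH]; intros Hk; [lia|]; simpl.
  destruct (Nat.eq_dec k n) as [->|].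
  - rewrite (rsum_ext n _ (fun _ => 0)), rsum_const, delta_refl; [lra|].
    intros i Hi; rewrite delta_neq by lia; lra.
  - rewrite IH, delta_neq by lia; lra.
Qed.

Lemma rsum_delta_l (n : nat) (f : nat -> R) (k : nat) :
  (k < n)%nat -> rsum n (fun j => f j * delta k j) = f k.
Proof.
  intros Hk; rewrite (rsum_ext n _ (fun j => f j * delta j k)).
  - now apply rsum_delta_r.
  - intros; now rewrite delta_sym.
Qed.

Lemma sum4_ext (n : nat) (f g : tensor4) :
  forall4 n (fun i j k l => f i j k l = g i j k l) -> sum4 n f = sum4 n g.
Proof.
  intros H; unfold sum4.
  repeat (apply rsum_ext; intros); auto.
Qed.

Lemma sum4_plus (n : nat) (f g : tensor4) :
  sum4 n (fun i j k l => f i j k l + g i j k l) = sum4 n f + sum4 n g.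
Proof.
  unfold sum4; rewrite <- rsum_plus.
  do 3 (apply rsum_ext; intros; rewrite <- rsum_plus). reflexivity.
Qed.

Lemma sum4_scal (n : nat) (c : R) (f : tensor4) :
  sum4 n (fun i j k l => c * f i j k l) = c * sum4 n f.
Proof.
  unfold sum4; rewrite <- rsum_scal_l.
  do 3 (apply rsum_ext; intros; rewrite <- rsum_scal_l). reflexivity.
Qed.

Lemma sum4_le (n : nat) (f g : tensor4) :
  forall4 n (fun i j k l => f i j k l <= g i j k l) -> sum4 n f <= sum4 n g.
Proof.
  intros H; unfold sum4.
  repeat (apply rsum_le; intros); auto.
Qed.

Lemma sum4_const (n : nat) (c : R) : sum4 n (fun _ _ _ _ => c) = INR n ^ 4 * c.
Proof. unfold sum4; rewrite !rsum_const; ring. Qed.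

Lemma sum4_term_le (n : nat) (f : tensor4) :
  forall4 n (fun i j k l => 0 <= f i j k l) ->
  forall4 n (fun i j k l => f i j k l <= sum4 n f).
Proof.
  intros H i j k l Hi Hj Hk Hl; unfold sum4.
  eapply Rle_trans; [|apply (rsum_term_le n (fun i => rsum n (fun j => rsum n (fun k => rsum n (fun l => f i j k l)))) i); auto].
  eapply Rle_trans; [|apply (rsum_term_le n (fun j => rsum n (fun k => rsum n (fun l => f i j k l))) j); auto].
  eapply Rle_trans; [|apply (rsum_term_le n (fun k => rsum n (fun l => f i j k l)) k); auto].
  apply (rsum_term_le n (fun l => f i j k l)); auto.
  all: intros; repeat (apply rsum_nonneg; intros); auto.
Qed.

Lemma sum4_swap_pairs (n : nat) (f : tensor4) :
  sum4 n f = sum4 n (fun i j k l => f k l i j).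
Proof.
  unfold sum4.
  transitivity (rsum n (fun i => rsum n (fun k => rsum n (fun j => rsum n (fun l => f i j k l))))).
  { apply rsum_ext; intros; apply rsum_swap. }
  rewrite rsum_swap. apply rsum_ext; intros k Hk.
  transitivity (rsum n (fun i => rsum n (fun l => rsum n (fun j => f i j k l)))).
  { apply rsum_ext; intros; apply rsum_swap. }
  rewrite rsum_swap; reflexivity.
Qed.

Lemma sum4_swap12 (n : nat) (f : tensor4) :
  sum4 n f = sum4 n (fun i j k l => f j i k l).
Proof. unfold sum4; apply rsum_swap. Qed.

Lemma sum4_swap34 (n : nat) (f : tensor4) :
  sum4 n f = sum4 n (fun i j k l => f i j l k).
Proof. unfold sum4; do 2 (apply rsum_ext; intros); apply rsum_swap. Qed.

(** * Tensors and symmetric forms *)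

Definition tadd (V W : tensor4) : tensor4 := fun i j k l => V i j k l + W i j k l.
Definition tscal (c : R) (V : tensor4) : tensor4 := fun i j k l => c * V i j k l.

Definition tbound (n : nat) (c : R) (V : tensor4) : Prop :=
  forall4 n (fun i j k l => Rabs (V i j k l) <= c).
Definition tclose (n : nat) (c : R) (V W : tensor4) : Prop :=
  forall4 n (fun i j k l => Rabs (V i j k l - W i j k l) <= c).
Definition teq (n : nat) (V W : tensor4) : Prop :=
  forall4 n (fun i j k l => V i j k l = W i j k l).

Lemma act_add n V W : is_act n V -> is_act n W -> is_act n (tadd V W).
Proof.
  intros HV HW i j k l Hi Hj Hk Hl; unfold tadd.
  destruct (HV i j k l) as (a1 & a2 & a3); auto.
  destruct (HW i j k l) as (b1 & b2 & b3); auto.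
  repeat split; lra.
Qed.

Lemma act_scal n c V : is_act n V -> is_act n (tscal c V).
Proof.
  intros HV i j k l Hi Hj Hk Hl; unfold tscal.
  destruct (HV i j k l) as (a1 & a2 & a3); auto.
  repeat split; [rewrite a1; ring | rewrite a2; ring |].
  transitivity (c * (V i j k l + V j k i l + V k i j l)); [ring | rewrite a3; ring].
Qed.

Lemma act_ext n V W : teq n V W -> is_act n V -> is_act n W.
Proof.
  intros E HV i j k l Hi Hj Hk Hl.
  destruct (HV i j k l) as (a1 & a2 & a3); auto.
  rewrite !E in * by auto. auto.
Qed.

Lemma act_odot n A B : is_sym n A -> is_sym n B -> is_act n (odot A B).
Proof.
  intros HA HB i j k l Hi Hj Hk Hl; unfold odot.
  repeat split.
  - ring.
  - rewrite (HA k i), (HA k j), (HA l i), (HA l j), (HB l j), (HB l i), (HB k j), (HB k i) by auto; ring.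
  - rewrite (HA k i), (HA k j), (HA j i), (HB k j), (HB k i), (HB j i) by auto; ring.
Qed.

Lemma sym_delta n : is_sym n delta.
Proof. intros i j _ _; apply delta_sym. Qed.

Lemma psd_add n M N : psd n M -> psd n N -> psd n (fun i k => M i k + N i k).
Proof.
  intros HM HN x. specialize (HM x); specialize (HN x).
  rewrite (rsum_ext n _ (fun i => rsum n (fun k => x i * M i k * x k) + rsum n (fun k => x i * N i k * x k))).
  - rewrite rsum_plus; lra.
  - intros; rewrite <- rsum_plus; apply rsum_ext; intros; ring.
Qed.

Lemma psd_scal n c M : 0 <= c -> psd n M -> psd n (fun i k => c * M i k).
Proof.
  intros Hc HM x. specialize (HM x).
  rewrite (rsum_ext n _ (fun i => c * rsum n (fun k => x i * M i k * x k))).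
  - rewrite rsum_scal_l; nra.
  - intros; rewrite <- rsum_scal_l; apply rsum_ext; intros; ring.
Qed.

Lemma psd_ext n M N :
  (forall i k, (i < n)%nat -> (k < n)%nat -> M i k = N i k) -> psd n M -> psd n N.
Proof.
  intros E HM x. specialize (HM x).
  erewrite rsum_ext; [exact HM|]; intros; apply rsum_ext; intros; now rewrite E.
Qed.

Lemma rsum_delta_quad n (x : nat -> R) c :
  rsum n (fun i => rsum n (fun k => x i * (c * delta i k) * x k)) = c * rsum n (fun i => x i ^ 2).
Proof.
  rewrite <- rsum_scal_l; apply rsum_ext; intros i Hi.
  rewrite (rsum_ext n _ (fun k => (x i * c * x k) * delta i k)) by (intros; ring).
  rewrite (rsum_delta_l n (fun k => x i * c * x k)) by auto; ring.
Qed.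

Lemma psd_delta n c : 0 <= c -> psd n (fun i k => c * delta i k).
Proof.
  intros Hc x; rewrite rsum_delta_quad.
  apply Rmult_le_pos; auto; apply rsum_nonneg; intros; nra.
Qed.

Lemma rsum_cauchy_schwarz1 n (f : nat -> R) : (rsum n f) ^ 2 <= INR n * rsum n (fun i => f i ^ 2).
Proof.
  induction n as [|n IH]; [simpl; lra|].
  rewrite S_INR; cbn [rsum].
  assert (0 <= rsum n (fun i => f i ^ 2)) by (apply rsum_nonneg; intros; nra).
  assert (Hn := pos_INR n).
  set (s := rsum n f) in *; set (q := rsum n (fun i => f i ^ 2)) in *; set (y := f n) in *.
  (* The cross term of (s + y)^2. Multiplied by n it follows from (s - n y)^2 >= 0 and the induction
     hypothesis s^2 <= n q; for n = 0 one has s = 0. *)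
  assert (2 * s * y <= q + INR n * y ^ 2); [|nra].
  destruct (Req_dec (INR n) 0) as [E|E].
  - rewrite E in *; assert (s = 0) by nra; nra.
  - assert (0 < INR n) by lra.
    apply (Rmult_le_reg_l (INR n)); auto.
    assert (Hsq := pow2_ge_0 (s - INR n * y)); nra.
Qed.

(** By Cauchy-Schwarz the quadratic form of M is at most g (sum |x_i|)^2 <= n g |x|^2, so n g bounds
    the largest eigenvalue. *)
Lemma psd_small n g M :
  (forall i k, (i < n)%nat -> (k < n)%nat -> Rabs (M i k) <= g) ->
  psd n (fun i k => INR n * g * delta i k - M i k).
Proof.
  intros HM x.
  rewrite (rsum_ext n _ (fun i => rsum n (fun k => x i * (INR n * g * delta i k) * x k) - rsum n (fun k => x i * M i k * x k)))
    by (intros; rewrite <- rsum_minus; apply rsum_ext; intros; ring).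
  rewrite rsum_minus, rsum_delta_quad.
  assert (rsum n (fun i => rsum n (fun k => x i * M i k * x k)) <= g * (rsum n (fun i => Rabs (x i))) ^ 2).
  { replace (g * (rsum n (fun i => Rabs (x i))) ^ 2)
      with (rsum n (fun i => rsum n (fun k => Rabs (x i) * g * Rabs (x k)))).
    - apply rsum_le; intros; apply rsum_le; intros.
      eapply Rle_trans; [apply Rle_abs|]. rewrite !Rabs_mult.
      apply Rmult_le_compat_r; [apply Rabs_pos|].
      apply Rmult_le_compat_l; [apply Rabs_pos|auto].
    - rewrite (rsum_ext n _ (fun i => Rabs (x i) * (g * rsum n (fun k => Rabs (x k)))))
        by (intros; rewrite rsum_scal_l; ring).
      rewrite rsum_scal_r; ring. }
  assert (Hcs := rsum_cauchy_schwarz1 n (fun i => Rabs (x i))).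
  cbv beta in Hcs.
  rewrite (rsum_ext n (fun i => Rabs (x i) ^ 2) (fun i => x i ^ 2)) in Hcs
    by (intros; rewrite <- Rsqr_pow2, <- Rsqr_abs, Rsqr_pow2; reflexivity).
  destruct n as [|m]; [simpl in *; lra|].
  assert (0 <= g) by (eapply Rle_trans; [apply Rabs_pos | apply (HM 0%nat 0%nat)]; lia).
  nra.
Qed.

(** * The PIC2 condition *)

Lemma fst_csum n f : fst (csum n f) = rsum n (fun i => fst (f i)).
Proof. induction n as [|n IH]; simpl; [reflexivity|]. now rewrite IH. Qed.

Lemma snd_csum n f : snd (csum n f) = rsum n (fun i => snd (f i)).
Proof. induction n as [|n IH]; simpl; [reflexivity|]. now rewrite IH. Qed.

Lemma fst_curv_c n T z w u v :
  fst (curv_c n T z w u v) =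
  sum4 n (fun i j k l => T i j k l * fst (cmul (cmul (z i) (w j)) (cmul (u k) (v l)))).
Proof.
  unfold curv_c, sum4.
  do 4 (rewrite fst_csum; apply rsum_ext; intros). reflexivity.
Qed.

Lemma snd_curv_c n T z w u v :
  snd (curv_c n T z w u v) =
  sum4 n (fun i j k l => T i j k l * snd (cmul (cmul (z i) (w j)) (cmul (u k) (v l)))).
Proof.
  unfold curv_c, sum4.
  do 4 (rewrite snd_csum; apply rsum_ext; intros). reflexivity.
Qed.

Lemma pic2_add n V W : pic2 n V -> pic2 n W -> pic2 n (tadd V W).
Proof.
  intros HV HW z w; specialize (HV z w); specialize (HW z w); cbv zeta in *.
  rewrite fst_curv_c, snd_curv_c in *.
  split.
  - rewrite <- (Rplus_0_r 0), <- (proj1 HV) at 1. rewrite <- (proj1 HW), <- sum4_plus.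
    apply sum4_ext; intros i j k l _ _ _ _; unfold tadd; ring.
  - erewrite sum4_ext with (g := fun i j k l => _ + _).
    + rewrite sum4_plus. apply Rplus_le_le_0_compat; [exact (proj2 HV) | exact (proj2 HW)].
    + intros i j k l _ _ _ _; unfold tadd; ring.
Qed.

Lemma pic2_scal n c V : 0 <= c -> pic2 n V -> pic2 n (tscal c V).
Proof.
  intros Hc HV z w; specialize (HV z w); cbv zeta in *.
  rewrite fst_curv_c, snd_curv_c in *.
  split.
  - rewrite <- (Rmult_0_r c), <- (proj1 HV), <- sum4_scal.
    apply sum4_ext; intros i j k l _ _ _ _; unfold tscal; ring.
  - erewrite sum4_ext with (g := fun i j k l => c * _).
    + rewrite sum4_scal. apply Rmult_le_pos; [exact Hc | exact (proj2 HV)].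
    + intros i j k l _ _ _ _; unfold tscal; ring.
Qed.

(** Write z_i w_j = A_ij + i B_ij with A, B real. Then R(z, w, conj z, conj w) is R(A,A) + R(B,B)
    plus i (R(B,A) - R(A,B)), and the imaginary part vanishes by pair symmetry. *)
Lemma pic2_of_curvature_operator_psd n T :
  is_act n T ->
  (forall A : bilin, 0 <= sum4 n (fun i j k l => T i j k l * (A i j * A k l))) ->
  pic2 n T.
Proof.
  intros HT Hop z w; cbv zeta. rewrite fst_curv_c, snd_curv_c.
  set (A := fun i j => fst (cmul (z i) (w j))).
  set (B := fun i j => snd (cmul (z i) (w j))).
  split.
  - set (F := fun i j k l => T i j k l * (B i j * A k l)).
    replace (sum4 n _) with (sum4 n (fun i j k l => F i j k l + (-1) * F k l i j)).
    + rewrite sum4_plus, sum4_scal, <- sum4_swap_pairs; ring.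
    + apply sum4_ext; intros i j k l Hi Hj Hk Hl; unfold F, A, B.
      rewrite <- (proj1 (proj2 (HT i j k l Hi Hj Hk Hl))); simpl; ring.
  - replace (sum4 n _) with
      (sum4 n (fun i j k l => T i j k l * (A i j * A k l) + T i j k l * (B i j * B k l))).
    + rewrite sum4_plus. apply Rplus_le_le_0_compat; apply Hop.
    + apply sum4_ext; intros i j k l _ _ _ _; unfold A, B; simpl; ring.
Qed.

(** T is skew in each pair of indices, so only the skew part of A counts, and A - A^T is twice that
    part in each of the two slots. *)
Lemma sum4_skew n T A :
  is_act n T ->
  sum4 n (fun i j k l => T i j k l * ((A i j - A j i) * (A k l - A l k))) =
  4 * sum4 n (fun i j k l => T i j k l * (A i j * A k l)).
Proof.
  intros HT.
  assert (H12 : forall B : bilin, sum4 n (fun i j k l => T i j k l * (A j i * B k l)) =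
                - sum4 n (fun i j k l => T i j k l * (A i j * B k l))).
  { intros B. rewrite sum4_swap12.
    replace (- sum4 n _) with ((-1) * sum4 n (fun i j k l => T i j k l * (A i j * B k l))) by ring.
    rewrite <- sum4_scal. apply sum4_ext; intros i j k l Hi Hj Hk Hl.
    rewrite (proj1 (HT j i k l Hj Hi Hk Hl)); ring. }
  assert (H34 : sum4 n (fun i j k l => T i j k l * (A i j * A l k)) =
                - sum4 n (fun i j k l => T i j k l * (A i j * A k l))).
  { rewrite sum4_swap34.
    replace (- sum4 n _) with ((-1) * sum4 n (fun i j k l => T i j k l * (A i j * A k l))) by ring.
    rewrite <- sum4_scal. apply sum4_ext; intros i j k l Hi Hj Hk Hl.
    destruct (HT i j l k Hi Hj Hl Hk) as (_ & e1 & _).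
    destruct (HT l k i j Hl Hk Hi Hj) as (e2 & _ & _).
    destruct (HT i j k l Hi Hj Hk Hl) as (_ & e3 & _).
    rewrite e1, e2, <- e3; ring. }
  rewrite (sum4_ext n _ (fun i j k l =>
     (T i j k l * (A i j * A k l) + (-1) * (T i j k l * (A i j * A l k))) +
     ((-1) * (T i j k l * (A j i * A k l)) + T i j k l * (A j i * A l k)))) by (intros i j k l _ _ _ _; ring).
  rewrite !sum4_plus, !sum4_scal, H34, (H12 A), (H12 (fun k l => A l k)), H34. ring.
Qed.

(** [odot delta delta] is twice the curvature tensor of the unit sphere, so the left side is 2 sum
    A_ij (A_ij - A_ji); swapping i and j in one half of it completes the square. *)
Lemma sum4_id_odot n (A : bilin) :
  sum4 n (fun i j k l => odot delta delta i j k l * (A i j * A k l)) =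
  rsum n (fun i => rsum n (fun j => (A i j - A j i) ^ 2)).
Proof.
  transitivity (rsum n (fun i => rsum n (fun j => 2 * (A i j * (A i j - A j i))))).
  - unfold sum4; apply rsum_ext; intros i Hi; apply rsum_ext; intros j Hj.
    rewrite (rsum_ext n _ (fun k => (2 * A i j * A k j) * delta i k + (- 2 * A i j * A k i) * delta j k)).
    + rewrite rsum_plus.
      rewrite (rsum_delta_l n (fun k => 2 * A i j * A k j)), (rsum_delta_l n (fun k => - 2 * A i j * A k i)) by auto; ring.
    + intros k Hk.
      rewrite (rsum_ext n _ (fun l => (2 * delta i k * A i j * A k l) * delta j l + (- 2 * delta j k * A i j * A k l) * delta i l)).
      * rewrite rsum_plus.
        rewrite (rsum_delta_l n (fun l => 2 * delta i k * A i j * A k l)),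
                (rsum_delta_l n (fun l => - 2 * delta j k * A i j * A k l)) by auto; ring.
      * intros l Hl; unfold odot; ring.
  - assert (E : rsum n (fun i => rsum n (fun j => A i j * (A i j - A j i))) =
                rsum n (fun i => rsum n (fun j => A j i * (A j i - A i j)))).
    { apply rsum_swap. }
    transitivity (rsum n (fun i => rsum n (fun j => A i j * (A i j - A j i))) +
                  rsum n (fun i => rsum n (fun j => A j i * (A j i - A i j)))).
    + rewrite <- E, <- rsum_plus; apply rsum_ext; intros.
      rewrite <- rsum_plus; apply rsum_ext; intros; ring.
    + rewrite <- rsum_plus; apply rsum_ext; intros.
      rewrite <- rsum_plus; apply rsum_ext; intros; ring.
Qed.

Lemma rsum2_cauchy_schwarz1 n (a : bilin) :
  (rsum n (fun i => rsum n (fun j => Rabs (a i j)))) ^ 2 <=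
  INR n ^ 2 * rsum n (fun i => rsum n (fun j => (a i j) ^ 2)).
Proof.
  eapply Rle_trans; [apply rsum_cauchy_schwarz1|].
  replace (INR n ^ 2 * _) with (INR n * (rsum n (fun i => INR n * rsum n (fun j => a i j ^ 2))))
    by (rewrite rsum_scal_l; ring).
  apply Rmult_le_compat_l; [apply pos_INR|].
  apply rsum_le; intros i Hi.
  eapply Rle_trans; [apply rsum_cauchy_schwarz1|].
  apply Rmult_le_compat_l; [apply pos_INR|].
  apply rsum_le; intros j Hj. rewrite pow2_abs; lra.
Qed.

(** Let a = A - A^T. The sphere contributes s |a|^2, and E contributes E(a,a)/4 by [sum4_skew],
    which is at least -(e/4) (sum |a_ij|)^2 >= -(e/4) n^2 |a|^2. Hence the factor 4 in the
    hypothesis. *)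
Lemma pic2_near_sphere n s e E :
  is_act n E -> tbound n e E -> INR n ^ 2 * e <= 4 * s ->
  pic2 n (tadd (tscal s (odot delta delta)) E).
Proof.
  intros HE He Hs.
  apply pic2_of_curvature_operator_psd.
  { apply act_add; auto. apply act_scal, act_odot; apply sym_delta. }
  intros A.
  rewrite (sum4_ext n _ (fun i j k l => s * (odot delta delta i j k l * (A i j * A k l)) + E i j k l * (A i j * A k l)))
    by (intros i j k l _ _ _ _; unfold tadd, tscal; ring).
  rewrite sum4_plus, sum4_scal, sum4_id_odot.
  assert (H4 := sum4_skew n E A HE).
  set (a := fun i j => A i j - A j i).
  change (sum4 n (fun i j k l => E i j k l * (a i j * a k l)) =
          4 * sum4 n (fun i j k l => E i j k l * (A i j * A k l))) in H4.
  change (0 <= s * rsum n (fun i => rsum n (fun j => (a i j) ^ 2)) +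
            sum4 n (fun i j k l => E i j k l * (A i j * A k l))).
  assert (Hb : - sum4 n (fun i j k l => E i j k l * (a i j * a k l)) <=
               e * (rsum n (fun i => rsum n (fun j => Rabs (a i j)))) ^ 2).
  { replace (- sum4 n _) with ((-1) * sum4 n (fun i j k l => E i j k l * (a i j * a k l))) by ring.
    rewrite <- sum4_scal.
    apply Rle_trans with (sum4 n (fun i j k l => e * (Rabs (a i j) * Rabs (a k l)))).
    - apply sum4_le; intros i j k l Hi Hj Hk Hl.
      eapply Rle_trans; [apply Rle_abs|].
      rewrite !Rabs_mult. replace (Rabs (-1)) with 1 by (rewrite Rabs_left; lra).
      rewrite Rmult_1_l.
      apply Rmult_le_compat_r; [apply Rmult_le_pos; apply Rabs_pos | apply He; auto].
    - rewrite sum4_scal. apply Req_le. f_equal. unfold sum4.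
      rewrite (rsum_ext n _ (fun i => rsum n (fun j => Rabs (a i j)) * rsum n (fun i => rsum n (fun j => Rabs (a i j))))).
      + rewrite rsum_scal_r; ring.
      + intros i Hi. rewrite <- rsum_scal_r; apply rsum_ext; intros j Hj.
        rewrite <- rsum_scal_l; apply rsum_ext; intros k Hk.
        rewrite <- rsum_scal_l; apply rsum_ext; intros l Hl. reflexivity. }
  assert (Hcs := rsum2_cauchy_schwarz1 n a).
  set (q := rsum n (fun i => rsum n (fun j => a i j ^ 2))) in *.
  assert (0 <= q) by (unfold q; repeat (apply rsum_nonneg; intros); apply pow2_ge_0).
  destruct n as [|m]; [unfold q, sum4; simpl; lra|].
  assert (0 <= e) by (eapply Rle_trans; [apply Rabs_pos | apply (He 0 0 0 0)%nat; lia]).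
  nra.
Qed.

(** * Ricci and scalar curvature, and their values on H (.) id *)

Lemma ric_add n V W i k : ric n (tadd V W) i k = ric n V i k + ric n W i k.
Proof. unfold ric, tadd; apply rsum_plus. Qed.
Lemma ric_scal n c V i k : ric n (tscal c V) i k = c * ric n V i k.
Proof. unfold ric, tscal; apply rsum_scal_l. Qed.
Lemma scal_add n V W : scal n (tadd V W) = scal n V + scal n W.
Proof. unfold scal; rewrite <- rsum_plus; apply rsum_ext; intros; apply ric_add. Qed.
Lemma scal_scal n c V : scal n (tscal c V) = c * scal n V.
Proof. unfold scal; rewrite <- rsum_scal_l; apply rsum_ext; intros; apply ric_scal. Qed.
Lemma ric0_add n V W i k : ric0 n (tadd V W) i k = ric0 n V i k + ric0 n W i k.
Proof. unfold ric0; rewrite ric_add, scal_add; ring. Qed.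
Lemma ric0_scal n c V i k : ric0 n (tscal c V) i k = c * ric0 n V i k.
Proof. unfold ric0; rewrite ric_scal, scal_scal; ring. Qed.

Lemma ric_ext n V W i k : teq n V W -> (i < n)%nat -> (k < n)%nat -> ric n V i k = ric n W i k.
Proof. intros E Hi Hk; apply rsum_ext; intros; now apply E. Qed.
Lemma scal_ext n V W : teq n V W -> scal n V = scal n W.
Proof. intros E; apply rsum_ext; intros; now apply ric_ext. Qed.

Lemma trace_add n A B : trace n (fun i k => A i k + B i k) = trace n A + trace n B.
Proof. apply rsum_plus. Qed.
Lemma trace_scal n c A : trace n (fun i k => c * A i k) = c * trace n A.
Proof. apply rsum_scal_l. Qed.
Lemma trace_delta n : trace n delta = INR n.
Proof.
  unfold trace; rewrite (rsum_ext n _ (fun _ => 1)), rsum_const; [ring|].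
  intros; apply delta_refl.
Qed.

Lemma ric_odot_id n A i k : (i < n)%nat -> (k < n)%nat ->
  ric n (odot A delta) i k = (INR n - 2) * A i k + trace n A * delta i k.
Proof.
  intros Hi Hk; unfold ric, odot.
  rewrite (rsum_ext n _ (fun j => A i k + (- (A i j * delta j k) + (- (A j k * delta i j) + A j j * delta i k)))).
  - rewrite !rsum_plus, !rsum_opp, rsum_const, rsum_scal_r.
    rewrite (rsum_delta_r n (fun j => A i j)), (rsum_delta_l n (fun j => A j k)) by auto.
    unfold trace; ring.
  - intros; rewrite delta_refl; ring.
Qed.

Lemma scal_odot_id n A : scal n (odot A delta) = 2 * (INR n - 1) * trace n A.
Proof.
  unfold scal.
  rewrite (rsum_ext n _ (fun i => (INR n - 2) * A i i + trace n A * 1)).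
  - rewrite rsum_plus, rsum_const, rsum_scal_l; fold (trace n A); ring.
  - intros; rewrite ric_odot_id, delta_refl by auto; ring.
Qed.

Lemma ric_sym n T : is_act n T -> is_sym n (ric n T).
Proof.
  intros HT i k Hi Hk; apply rsum_ext; intros j Hj.
  exact (proj1 (proj2 (HT i j k j Hi Hj Hk Hj))).
Qed.

Lemma trace_ric0 n T : (0 < n)%nat -> trace n (ric0 n T) = 0.
Proof.
  intros Hn; unfold trace, ric0.
  rewrite (rsum_ext n _ (fun i => ric n T i i - / INR n * scal n T))
    by (intros; rewrite delta_refl; ring).
  rewrite rsum_minus, rsum_const; fold (scal n T).
  field; apply not_0_INR; lia.
Qed.

Lemma ric_bound n c T i k : tbound n c T -> (i < n)%nat -> (k < n)%nat -> Rabs (ric n T i k) <= INR n * c.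
Proof. intros HT Hi Hk; apply rsum_abs_le; intros; apply HT; auto. Qed.

Lemma scal_bound n c T : tbound n c T -> Rabs (scal n T) <= INR n * (INR n * c).
Proof. intros HT; apply rsum_abs_le; intros; apply ric_bound; auto. Qed.

(** For standard basis vectors z = e_i and w = e_j the PIC2 inequality reads R_ijij >= 0, and scal
    is the sum of these entries. *)
Lemma pic2_scal_nonneg n T : is_act n T -> pic2 n T -> 0 <= scal n T.
Proof.
  intros HT Hp; unfold scal, ric.
  apply rsum_nonneg; intros i Hi; apply rsum_nonneg; intros j Hj.
  destruct (Hp (fun a => (delta a i, 0)) (fun a => (delta a j, 0))) as [_ H].
  rewrite fst_curv_c in H.
  eapply Rle_trans; [exact H|]. apply Req_le.
  unfold sum4.
  rewrite (rsum_ext n _ (fun a => T a j a j * delta a i)).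
  - now apply (rsum_delta_r n (fun a => T a j a j)).
  - intros a Ha.
    rewrite (rsum_ext n _ (fun b => (T a b a b * delta a i) * delta b j)).
    + now apply (rsum_delta_r n (fun b => T a b a b * delta a i)).
    + intros b Hb.
      rewrite (rsum_ext n _ (fun c => (T a b c j * delta a i * delta b j) * delta c i)).
      * rewrite (rsum_delta_r n (fun c => T a b c j * delta a i * delta b j)) by auto.
        unfold delta; destruct (Nat.eqb_spec a i), (Nat.eqb_spec b j); subst; ring.
      * intros c Hc.
        rewrite (rsum_ext n _ (fun d => (T a b c d * delta a i * delta b j * delta c i) * delta d j)).
        -- now apply (rsum_delta_r n (fun d => T a b c d * delta a i * delta b j * delta c i)).
        -- intros d Hd; simpl; ring.
Qed.

(** * Decompositions S + H (.) id *)

(** Keeping the trace [h] and the upper bound [L] of H as separate parameters makes the notion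
    linear: both add under sums and scale under nonnegative multiples. The cones correspond to
    [L = b * h], the final set to [L = f h]. *)
Definition splits (n : nat) (theta : R) (T : tensor4) (h L : R) : Prop :=
  exists (S : tensor4) (H : bilin),
    is_act n S /\ is_sym n H /\
    forall4 n (fun i j k l => T i j k l = S i j k l + odot H id_form i j k l) /\
    pic2 n S /\
    (forall i k, (i < n)%nat -> (k < n)%nat -> ric0 n S i k = 0) /\
    trace n H = h /\
    psd n (fun i k => L * delta i k - H i k) /\
    0 <= h - theta * scal n S.

Lemma splits_ext n theta V W h L : teq n V W -> splits n theta V h L -> splits n theta W h L.
Proof.
  intros E (S & H & a1 & a2 & a3 & a4).
  exists S, H; repeat (split; [assumption|]); split; [|assumption].
  intros i j k l Hi Hj Hk Hl; rewrite <- E by auto; now apply a3.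
Qed.

Lemma splits_add n theta V W h L h' L' :
  splits n theta V h L -> splits n theta W h' L' -> splits n theta (tadd V W) (h + h') (L + L').
Proof.
  intros (S & H & a1 & a2 & a3 & a4 & a5 & a6 & a7 & a8)
         (S' & H' & b1 & b2 & b3 & b4 & b5 & b6 & b7 & b8).
  exists (tadd S S'), (fun i k => H i k + H' i k).
  split; [now apply act_add|].
  split; [intros i k Hi Hk; now rewrite a2, b2|].
  split; [intros i j k l Hi Hj Hk Hl; unfold tadd; rewrite a3, b3 by auto; unfold odot; ring|].
  split; [now apply pic2_add|].
  split; [intros i k Hi Hk; rewrite ric0_add, a5, b5 by auto; ring|].
  split; [rewrite trace_add; lra|].
  split.
  - eapply psd_ext; [|exact (psd_add _ _ _ a7 b7)]; intros; simpl; ring.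
  - rewrite scal_add; lra.
Qed.

Lemma splits_scal n theta c V h L :
  0 <= c -> splits n theta V h L -> splits n theta (tscal c V) (c * h) (c * L).
Proof.
  intros Hc (S & H & a1 & a2 & a3 & a4 & a5 & a6 & a7 & a8).
  exists (tscal c S), (fun i k => c * H i k).
  split; [now apply act_scal|].
  split; [intros i k Hi Hk; now rewrite a2|].
  split; [intros i j k l Hi Hj Hk Hl; unfold tscal; rewrite a3 by auto; unfold odot; ring|].
  split; [now apply pic2_scal|].
  split; [intros i k Hi Hk; rewrite ric0_scal, a5 by auto; ring|].
  split; [rewrite trace_scal; now rewrite a6|].
  split.
  - eapply psd_ext; [|exact (psd_scal _ c _ Hc a7)]; intros; simpl; ring.
  - rewrite scal_scal; nra.
Qed.

Lemma splits_mono n theta V h L L' : L <= L' -> splits n theta V h L -> splits n theta V h L'.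
Proof.
  intros HL (S & H & a1 & a2 & a3 & a4 & a5 & a6 & a7 & a8).
  exists S, H; repeat (split; [assumption|]); split; [|assumption].
  eapply psd_ext; [|exact (psd_add _ _ _ a7 (psd_delta n (L' - L) ltac:(lra)))].
  intros; simpl; ring.
Qed.

Lemma splits_act n theta V h L : splits n theta V h L -> is_act n V.
Proof.
  intros (S & H & a1 & a2 & a3 & _).
  apply (act_ext n (tadd S (odot H delta))).
  - intros i j k l Hi Hj Hk Hl; symmetry; now apply a3.
  - apply act_add; [assumption|]; apply act_odot; [assumption|apply sym_delta].
Qed.

Lemma splits_trace_nonneg n theta V h L : 0 <= theta -> splits n theta V h L -> 0 <= h.
Proof.
  intros theta_pos (S & H & a1 & a2 & a3 & a4 & a5 & a6 & a7 & a8).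
  assert (0 <= scal n S) by now apply pic2_scal_nonneg. nra.
Qed.

(** scal(H (.) id) = 2 (n - 1) tr(H), and the remaining summand scal(S) is nonnegative by PIC2. *)
Lemma splits_trace_le n theta V h L : splits n theta V h L -> 2 * (INR n - 1) * h <= scal n V.
Proof.
  intros (S & H & a1 & a2 & a3 & a4 & a5 & a6 & a7 & a8).
  assert (0 <= scal n S) by now apply pic2_scal_nonneg.
  rewrite (scal_ext n V (tadd S (odot H delta))) by (intros i j k l; apply a3).
  rewrite scal_add, scal_odot_id, a6; lra.
Qed.

Lemma cone_C_splits n sigma theta T : 0 < INR n - 2 * sigma ->
  cone_C n sigma theta T <-> exists h, splits n theta T h (/ (INR n - 2 * sigma) * h).
Proof.
  intros Hs; split.
  - intros (S & H & a1 & a2 & a3 & a4 & a5 & a6 & a7).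
    exists (trace n H), S, H; repeat (split; [assumption|]); split; [reflexivity|]; split; [|assumption].
    eapply psd_ext; [|apply (psd_scal n (/ (INR n - 2 * sigma)) _) with (2 := a6)].
    + intros; simpl; field; lra.
    + apply Rlt_le, Rinv_0_lt_compat, Hs.
  - intros (h & S & H & a1 & a2 & a3 & a4 & a5 & <- & a6 & a7).
    exists S, H; repeat (split; [assumption|]); split; [|assumption].
    eapply psd_ext; [|apply (psd_scal n (INR n - 2 * sigma) _) with (2 := a6)].
    + intros; simpl; field; lra.
    + lra.
Qed.

Lemma set_f_splits n f theta T : set_f n f theta T <-> exists h, splits n theta T h (f h).
Proof.
  split.
  - intros (S & H & a1 & a2 & a3 & a4 & a5 & a6 & a7).
    exists (trace n H), S, H; repeat (split; [assumption|]); split; [reflexivity|]; auto.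
  - intros (h & S & H & a1 & a2 & a3 & a4 & a5 & <- & a6 & a7).
    exists S, H; repeat (split; [assumption|]); auto.
Qed.

(** * A neighbourhood of the round sphere *)

Definition sphere (c : R) : tensor4 := tscal c (odot delta delta).

Lemma sphere_bound n c : 0 <= c -> tbound n (4 * c) (sphere c).
Proof.
  intros Hc i j k l _ _ _ _; unfold sphere, tscal, odot, delta.
  repeat destruct (Nat.eqb _ _); apply Rabs_le; lra.
Qed.

Lemma sphere_act n c : is_act n (sphere c).
Proof. apply act_scal, act_odot; apply sym_delta. Qed.

(** Take c = s + 1: the part 1 becomes H = id, the part s goes into S. The traceless Ricci part of E
    is moved into H as G = Ric0(E)/(n-2), since Ric0(G (.) id) = (n-2) G for traceless G; then E - G
    (.) id has no traceless Ricci part and goes into S, where the sphere of size s keeps PIC2. There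
    is room for G because id <= (1/n) tr(H) id while 1/(n-2) is allowed. *)
Lemma splits_near_sphere n theta : (5 <= n)%nat -> 0 <= theta ->
  exists c rho, 0 < c /\ 0 < rho /\
  forall E, is_act n E -> tbound n rho E ->
    splits n theta (tadd (sphere c) E) (INR n) (/ (INR n - 2) * INR n).
Proof.
  intros Hn Ht.
  assert (HN : 5 <= INR n) by (apply (le_INR 5) in Hn; simpl in Hn; lra).
  set (N := INR n) in *.
  (* So small that theta times scal of [sphere s], that is 2 theta s n (n - 1), takes at most half
     of tr(H) = n. *)
  set (s := / (4 * (N - 1) * (theta + 1))).
  assert (Hs : 0 < s) by (apply Rinv_0_lt_compat; nra).
  (* The three bounds serve PIC2 of S, the other half of tr(H), which pays for theta scal(E), and n
     g <= 2/(n-2), the room between id and n/(n-2) id. *)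
  set (rho := Rmin (s / (4 * N ^ 3)) (Rmin (/ (2 * N * (theta + 1))) (/ (N ^ 3)))).
  assert (0 < N ^ 3) by (apply pow_lt; lra).
  assert (Hrho : 0 < rho).
  { repeat apply Rmin_pos; try apply Rdiv_lt_0_compat; try apply Rinv_0_lt_compat; nra. }
  assert (Hr1 : rho * (4 * N ^ 3) <= s).
  { apply Rle_trans with (s / (4 * N ^ 3) * (4 * N ^ 3)); [|apply Req_le; field; lra].
    apply Rmult_le_compat_r; [lra|]. apply Rmin_l. }
  assert (Hr2 : rho * (2 * N * (theta + 1)) <= 1).
  { apply Rle_trans with (/ (2 * N * (theta + 1)) * (2 * N * (theta + 1))); [|apply Req_le; field; lra].
    apply Rmult_le_compat_r; [nra|]. eapply Rle_trans; [apply Rmin_r|apply Rmin_l]. }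
  assert (Hr3 : rho * N ^ 3 <= 1).
  { apply Rle_trans with (/ N ^ 3 * N ^ 3); [|apply Req_le; field; lra].
    apply Rmult_le_compat_r; [lra|]. eapply Rle_trans; [apply Rmin_r|apply Rmin_r]. }
  exists (s + 1), rho; split; [lra|]; split; [assumption|].
  intros E HE Hb.
  set (G := fun i k => / (N - 2) * ric0 n E i k).
  assert (HGsym : is_sym n G).
  { intros i k Hi Hk; unfold G, ric0; rewrite (ric_sym n E HE i k), (delta_sym i k) by auto; ring. }
  assert (HGtr : trace n G = 0).
  { unfold G; rewrite trace_scal, trace_ric0 by lia; ring. }
  set (g := / (N - 2) * (2 * N * rho)).
  assert (Hi2 : 0 < / (N - 2)) by (apply Rinv_0_lt_compat; lra).
  assert (HGb : forall i k, (i < n)%nat -> (k < n)%nat -> Rabs (G i k) <= g).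
  { intros i k Hi Hk; unfold G, g; rewrite Rabs_mult, (Rabs_pos_eq (/ (N - 2))) by lra.
    apply Rmult_le_compat_l; [lra|]. unfold ric0.
    assert (H1 := ric_bound n rho E i k Hb Hi Hk); assert (H2 := scal_bound n rho E Hb); fold N in H1, H2.
    assert (H3 : Rabs (/ N * scal n E * delta i k) <= N * rho).
    { rewrite !Rabs_mult, (Rabs_pos_eq (/ N)) by (apply Rlt_le, Rinv_0_lt_compat; lra).
      assert (Rabs (delta i k) <= 1) by (unfold delta; destruct (Nat.eqb i k); rewrite Rabs_pos_eq; lra).
      assert (/ N * Rabs (scal n E) <= N * rho).
      { apply (Rmult_le_reg_l N); [lra|]. rewrite <- Rmult_assoc, Rinv_r by lra. lra. }
      assert (0 <= / N * Rabs (scal n E)).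
      { apply Rmult_le_pos; [apply Rlt_le, Rinv_0_lt_compat; lra|apply Rabs_pos]. }
      assert (0 <= Rabs (delta i k)) by apply Rabs_pos. nra. }
    eapply Rle_trans; [apply Rabs_triang|]. rewrite Rabs_Ropp; fold N; lra. }
  assert (Hg3 : g * 3 <= 2 * N * rho).
  { unfold g. assert (/ (N - 2) <= / 3) by (apply Rinv_le_contravar; lra). assert (0 <= 2 * N * rho) by nra. nra. }
  assert (Hg0 : 0 <= g) by (unfold g; repeat apply Rmult_le_pos; lra).
  set (E' := tadd E (tscal (-1) (odot G delta))).
  assert (HE' : is_act n E').
  { apply act_add; auto. apply act_scal, act_odot; [assumption|apply sym_delta]. }
  exists (tadd (sphere s) E'), (fun i k => delta i k + G i k).
  assert (HS : scal n (tadd (sphere s) E') = s * (2 * (N - 1) * N) + scal n E).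
  { unfold E', sphere. rewrite !scal_add, !scal_scal, !scal_odot_id, HGtr, trace_delta; fold N; ring. }
  split; [apply act_add; auto; apply sphere_act|].
  split; [intros i k Hi Hk; rewrite (HGsym i k), delta_sym by auto; ring|].
  split; [intros i j k l _ _ _ _; unfold E', sphere, tadd, tscal, odot, id_form; ring|].
  split.
  { apply (pic2_near_sphere n s (rho + 4 * g)); auto.
    - intros i j k l Hi Hj Hk Hl; unfold E', tadd, tscal, odot.
      assert (HD : forall a b c d, (a < n)%nat -> (b < n)%nat -> Rabs (G a b * delta c d) <= g).
      { intros a b c d Ha Hb'; rewrite Rabs_mult.
        assert (Rabs (delta c d) <= 1) by (unfold delta; destruct (Nat.eqb c d); rewrite Rabs_pos_eq; lra).
        assert (0 <= Rabs (delta c d)) by apply Rabs_pos.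
        assert (Rabs (G a b) <= g) by auto. assert (0 <= Rabs (G a b)) by apply Rabs_pos. nra. }
      assert (h0 := Hb i j k l Hi Hj Hk Hl).
      assert (h1 := HD i k j l Hi Hk); assert (h2 := HD i l j k Hi Hl).
      assert (h3 := HD j k i l Hj Hk); assert (h4 := HD j l i k Hj Hl).
      apply Rabs_le_inv in h0, h1, h2, h3, h4. apply Rabs_le; lra.
    - fold N. assert (g <= N * rho) by nra. assert (0 < N ^ 2) by nra.
      apply Rle_trans with (N ^ 2 * (5 * N * rho)); [|nra].
      apply Rmult_le_compat_l; nra. }
  split.
  { intros i k Hi Hk. unfold ric0. rewrite HS.
    unfold E', sphere. rewrite !ric_add, !ric_scal, !ric_odot_id, HGtr, trace_delta by auto.
    unfold G, ric0; fold N. field; lra. }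
  split; [rewrite trace_add, HGtr, trace_delta; fold N; ring|].
  split.
  - apply (psd_ext n (fun i k => (N * g * delta i k - G i k) + (/ (N - 2) * N - 1 - N * g) * delta i k)).
    + intros; ring.
    + apply psd_add; [apply psd_small, HGb|]. apply psd_delta.
      replace (/ (N - 2) * N - 1) with (/ (N - 2) * 2) by (field; lra).
      unfold g. replace (/ (N - 2) * 2 - N * (/ (N - 2) * (2 * N * rho))) with
        (/ (N - 2) * (2 * (1 - N ^ 2 * rho))) by ring.
      apply Rmult_le_pos; [lra|]. assert (N ^ 2 * rho <= N ^ 3 * rho); [|nra].
      apply Rmult_le_compat_r; [lra|]. simpl. nra.
  - rewrite HS.
    assert (Hsc := scal_bound n rho E Hb); fold N in Hsc. apply Rabs_le_inv in Hsc.
    assert (Hs1 : s * (4 * (N - 1) * (theta + 1)) = 1) by (unfold s; field; nra).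
    assert (theta * (s * (2 * (N - 1) * N)) <= N / 2).
    { apply Rle_trans with (N / 2 * (s * (4 * (N - 1) * (theta + 1)))); [|rewrite Hs1; lra].
      replace (N / 2 * (s * (4 * (N - 1) * (theta + 1)))) with
        (theta * (s * (2 * (N - 1) * N)) + s * (2 * (N - 1) * N)) by field.
      assert (0 <= s * (2 * (N - 1) * N)); [|lra]. apply Rmult_le_pos; nra. }
    assert (theta * scal n E <= N / 2).
    { apply Rle_trans with (theta * (N * (N * rho))).
      - apply Rmult_le_compat_l; lra.
      - apply Rle_trans with (N / 2 * (rho * (2 * N * (theta + 1)))); [|nra].
        replace (N / 2 * (rho * (2 * N * (theta + 1)))) with (theta * (N * (N * rho)) + N * (N * rho)) by field.
        assert (0 <= N * (N * rho)) by (apply Rmult_le_pos; nra). lra. }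
    lra.
Qed.

(** * The quadratic term of the Hamilton ODE *)

(** Hamilton's quadratic tensor B; written with it, Q shows its symmetries. *)
Definition Bsq (n : nat) (T : tensor4) : tensor4 := fun i j k l =>
  rsum n (fun p => rsum n (fun q => T i p j q * T k p l q)).

Lemma Bsq_comm n T i j k l : Bsq n T i j k l = Bsq n T k l i j.
Proof. unfold Bsq; do 2 (apply rsum_ext; intros); ring. Qed.

Lemma Bsq_flip n T i j k l : is_act n T ->
  (i < n)%nat -> (j < n)%nat -> (k < n)%nat -> (l < n)%nat ->
  Bsq n T i j k l = Bsq n T j i l k.
Proof.
  intros HT Hi Hj Hk Hl; unfold Bsq; rewrite rsum_swap.
  apply rsum_ext; intros q Hq; apply rsum_ext; intros p Hp.
  rewrite (proj1 (proj2 (HT i p j q Hi Hp Hj Hq))), (proj1 (proj2 (HT k p l q Hk Hp Hl Hq))).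
  reflexivity.
Qed.

(** By the first Bianchi identity T_ijpq = T_ipjq - T_iqjp. Inserted in both factors of the first
    sum of [bform], this gives four products, half of which take the form of [Bsq] after exchanging
    p and q; the second sum already has this form. *)
Lemma Qc_Bsq n T i j k l : is_act n T ->
  (i < n)%nat -> (j < n)%nat -> (k < n)%nat -> (l < n)%nat ->
  Qc n T i j k l =
  2 * (Bsq n T i j k l - Bsq n T i j l k + Bsq n T i k j l - Bsq n T i l j k).
Proof.
  intros HT Hi Hj Hk Hl.
  assert (Hb : forall a b p q, (a < n)%nat -> (b < n)%nat -> (p < n)%nat -> (q < n)%nat ->
            T a b p q = T a p b q - T a q b p).
  { intros a b p q Ha Hb Hp Hq.
    destruct (HT a b p q Ha Hb Hp Hq) as (_ & _ & e1).
    destruct (HT b p a q Hb Hp Ha Hq) as (_ & e2 & _).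
    destruct (HT p a b q Hp Ha Hb Hq) as (e3 & _ & _). lra. }
  assert (H1 : rsum n (fun p => rsum n (fun q => T i j p q * T k l p q + T k l p q * T i j p q)) =
               4 * (Bsq n T i j k l - Bsq n T i j l k)).
  { rewrite (rsum_ext n _ (fun p => rsum n (fun q =>
       2 * (T i p j q * T k p l q - T i p j q * T l p k q)) + rsum n (fun q =>
       2 * (T i q j p * T k q l p - T i q j p * T l q k p)))).
    - rewrite rsum_plus, (rsum_swap n n (fun p q => 2 * (T i q j p * T k q l p - T i q j p * T l q k p))).
      replace (4 * (Bsq n T i j k l - Bsq n T i j l k)) with
        (2 * (Bsq n T i j k l - Bsq n T i j l k) + 2 * (Bsq n T i j k l - Bsq n T i j l k)) by ring.
      f_equal; unfold Bsq; rewrite <- rsum_minus, <- rsum_scal_l; apply rsum_ext; intros;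
        rewrite <- rsum_minus, <- rsum_scal_l; reflexivity.
    - intros p Hp; rewrite <- rsum_plus; apply rsum_ext; intros q Hq.
      rewrite (Hb i j p q), (Hb k l p q) by auto.
      destruct (HT k p l q Hk Hp Hl Hq) as (_ & e1 & _).
      destruct (HT k q l p Hk Hq Hl Hp) as (_ & e2 & _).
      rewrite <- e1, <- e2; ring. }
  assert (H2 : rsum n (fun p => rsum n (fun q =>
      T i p k q * T j p l q - T i p l q * T j p k q
      - T j p k q * T i p l q + T j p l q * T i p k q)) =
      2 * (Bsq n T i k j l - Bsq n T i l j k)).
  { unfold Bsq; rewrite <- rsum_minus, <- rsum_scal_l; apply rsum_ext; intros.
    rewrite <- rsum_minus, <- rsum_scal_l; apply rsum_ext; intros; ring. }
  unfold Qc, bform; rewrite H1, H2; field.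
Qed.

(** In terms of B the Bianchi sum cancels up to the two symmetries of [Bsq]. The lemma matters
    because interiors are taken among algebraic curvature tensors, so perturbations of Q(T) must be
    algebraic for transversality to apply to them. *)
Lemma Qc_act n T : is_act n T -> is_act n (Qc n T).
Proof.
  intros HT i j k l Hi Hj Hk Hl.
  rewrite !Qc_Bsq by auto.
  assert (e1 := Bsq_flip n T i j k l HT Hi Hj Hk Hl); assert (e2 := Bsq_flip n T i j l k HT Hi Hj Hl Hk).
  assert (e3 := Bsq_flip n T i k j l HT Hi Hk Hj Hl); assert (e4 := Bsq_flip n T j k i l HT Hj Hk Hi Hl).
  assert (e5 := Bsq_flip n T j k l i HT Hj Hk Hl Hi).
  assert (f1 := Bsq_comm n T i k j l); assert (f2 := Bsq_comm n T i l j k).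
  assert (f3 := Bsq_comm n T i j k l); assert (f4 := Bsq_comm n T j i k l).
  assert (f5 := Bsq_comm n T j l k i).
  repeat split; lra.
Qed.

Lemma Qc_scal n c T i j k l : Qc n (tscal c T) i j k l = c ^ 2 * Qc n T i j k l.
Proof.
  unfold Qc, bform. rewrite Rmult_plus_distr_l. f_equal.
  - rewrite <- Rmult_assoc, (Rmult_comm _ (/2)), Rmult_assoc. f_equal. rewrite <- rsum_scal_l.
    apply rsum_ext; intros; rewrite <- rsum_scal_l; apply rsum_ext; intros; unfold tscal; ring.
  - rewrite <- rsum_scal_l.
    apply rsum_ext; intros; rewrite <- rsum_scal_l; apply rsum_ext; intros; unfold tscal; ring.
Qed.

Lemma Rabs_mult_diff a b a' b' M e :
  Rabs a <= M -> Rabs b' <= M -> Rabs (a - a') <= e -> Rabs (b - b') <= e ->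
  Rabs (a * b - a' * b') <= 2 * M * e.
Proof.
  intros Ha Hb Hda Hdb.
  replace (a * b - a' * b') with (a * (b - b') + (a - a') * b') by ring.
  eapply Rle_trans; [apply Rabs_triang|]. rewrite !Rabs_mult.
  assert (0 <= Rabs a) by apply Rabs_pos. assert (0 <= Rabs b') by apply Rabs_pos.
  assert (0 <= Rabs (a - a')) by apply Rabs_pos. assert (0 <= Rabs (b - b')) by apply Rabs_pos.
  nra.
Qed.

(** Each product of entries changes by at most 2 M e. Two products with factor 1/2 and four more
    give 2 + 8 = 10, and n^2 counts the pairs p, q. *)
Lemma Qc_lipschitz n M e V W :
  tbound n M V -> tbound n M W -> tclose n e V W ->
  tclose n (10 * INR n ^ 2 * M * e) (Qc n V) (Qc n W).
Proof.
  intros HV HW HC i j k l Hi Hj Hk Hl.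
  assert (HP : forall a b c d a' b' c' d',
    (a < n)%nat -> (b < n)%nat -> (c < n)%nat -> (d < n)%nat ->
    (a' < n)%nat -> (b' < n)%nat -> (c' < n)%nat -> (d' < n)%nat ->
    - (2 * M * e) <= V a b c d * V a' b' c' d' - W a b c d * W a' b' c' d' <= 2 * M * e).
  { intros; apply Rabs_le_inv, Rabs_mult_diff; auto. }
  unfold Qc, bform.
  match goal with |- Rabs (/2 * ?A + ?B - (/2 * ?A' + ?B')) <= _ =>
    assert (H1 : Rabs (A - A') <= INR n * (INR n * (4 * M * e)));
    [|assert (H2 : Rabs (B - B') <= INR n * (INR n * (8 * M * e)))] end.
  - rewrite <- rsum_minus; apply rsum_abs_le; intros p Hp.
    rewrite <- rsum_minus; apply rsum_abs_le; intros q Hq.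
    assert (a1 := HP i j p q k l p q Hi Hj Hp Hq Hk Hl Hp Hq).
    apply Rabs_le; lra.
  - rewrite <- rsum_minus; apply rsum_abs_le; intros p Hp.
    rewrite <- rsum_minus; apply rsum_abs_le; intros q Hq.
    assert (a1 := HP i p k q j p l q Hi Hp Hk Hq Hj Hp Hl Hq).
    assert (a2 := HP i p l q j p k q Hi Hp Hl Hq Hj Hp Hk Hq).
    apply Rabs_le; lra.
  - apply Rabs_le_inv in H1, H2. apply Rabs_le. nra.
Qed.

(** This is the Lipschitz estimate against the zero tensor [tscal 0 V], which has distance M from
    V. *)
Lemma Qc_bound n M V : tbound n M V -> tbound n (10 * INR n ^ 2 * M * M) (Qc n V).
Proof.
  intros HV i j k l Hi Hj Hk Hl.
  assert (0 <= M) by (eapply Rle_trans; [apply Rabs_pos | apply (HV i j k l); auto]).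
  assert (H0 : Qc n (tscal 0 V) i j k l = 0) by (rewrite Qc_scal; ring).
  rewrite <- (Rminus_0_r (Qc n V i j k l)), <- H0.
  apply Qc_lipschitz; auto; intros a b c d Ha Hb Hc Hd; unfold tscal.
  - rewrite Rmult_0_l, Rabs_R0; auto.
  - rewrite Rmult_0_l, Rminus_0_r; auto.
Qed.

(** * Norms, and estimates along solutions of the ODE *)

Definition nrm (n : nat) (V : tensor4) : R := sum4 n (fun i j k l => Rabs (V i j k l)).

Lemma nrm_bound n V : tbound n (nrm n V) V.
Proof.
  apply (sum4_term_le n (fun i j k l => Rabs (V i j k l))).
  intros i j k l _ _ _ _; apply Rabs_pos.
Qed.

Lemma nrm_nonneg n V : 0 <= nrm n V.
Proof.
  rewrite <- (Rmult_0_r (INR n ^ 4)), <- sum4_const.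
  apply sum4_le; intros i j k l _ _ _ _; apply Rabs_pos.
Qed.

Lemma nrm_le n c V : tbound n c V -> nrm n V <= INR n ^ 4 * c.
Proof. intros H; rewrite <- sum4_const; apply sum4_le, H. Qed.

Lemma nrm_scal n c V : 0 <= c -> nrm n (tscal c V) = c * nrm n V.
Proof.
  intros Hc; unfold nrm, tscal; rewrite <- sum4_scal; apply sum4_ext; intros i j k l _ _ _ _.
  now rewrite Rabs_mult, (Rabs_pos_eq c).
Qed.

Lemma nrm_close n e V W : tclose n e V W -> nrm n V <= nrm n W + INR n ^ 4 * e.
Proof.
  intros H; unfold nrm; rewrite <- sum4_const, <- sum4_plus.
  apply sum4_le; intros i j k l Hi Hj Hk Hl.
  assert (H1 := H i j k l Hi Hj Hk Hl).
  assert (H2 := Rabs_triang (V i j k l - W i j k l) (W i j k l)).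
  replace (V i j k l - W i j k l + W i j k l) with (V i j k l) in H2 by ring. lra.
Qed.

Lemma tclose_of_tdist2 n e V W : 0 <= e -> tdist2 n V W < e ^ 2 -> tclose n e V W.
Proof.
  intros He H i j k l Hi Hj Hk Hl.
  assert (H1 : (V i j k l - W i j k l) ^ 2 <= tdist2 n V W).
  { apply (sum4_term_le n (fun i j k l => (V i j k l - W i j k l) ^ 2)); auto.
    intros a b c d _ _ _ _; apply pow2_ge_0. }
  apply Rabs_le; split; nra.
Qed.

Lemma tdist2_of_tclose n eps : (0 < n)%nat -> 0 < eps ->
  exists e, 0 < e /\ forall V W, tclose n e V W -> tdist2 n V W < eps.
Proof.
  intros Hn Heps.
  assert (HN : 0 < INR n) by (apply lt_0_INR; lia).
  assert (HN4 : 0 < INR n ^ 4) by now apply pow_lt.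
  (* Capped at 1 so that e^2 <= e. *)
  exists (Rmin 1 (eps / (2 * INR n ^ 4))).
  assert (He : 0 < eps / (2 * INR n ^ 4)) by (apply Rdiv_lt_0_compat; lra).
  set (e := Rmin 1 (eps / (2 * INR n ^ 4))).
  assert (0 < e) by (apply Rmin_pos; lra). split; [assumption|].
  assert (e <= 1) by apply Rmin_l.
  assert (e <= eps / (2 * INR n ^ 4)) by apply Rmin_r.
  intros V W H2.
  apply Rle_lt_trans with (INR n ^ 4 * e ^ 2).
  - rewrite <- sum4_const. apply sum4_le; intros i j k l Hi Hj Hk Hl.
    rewrite <- pow2_abs. apply pow_incr; split; [apply Rabs_pos | apply H2; auto].
  - apply Rle_lt_trans with (INR n ^ 4 * (eps / (2 * INR n ^ 4))).
    + apply Rmult_le_compat_l; nra.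
    + replace (INR n ^ 4 * (eps / (2 * INR n ^ 4))) with (eps / 2) by (field; lra). lra.
Qed.

Lemma tbound_scal n c a V : 0 <= c -> tbound n a V -> tbound n (c * a) (tscal c V).
Proof.
  intros Hc HV i j k l Hi Hj Hk Hl; unfold tscal.
  rewrite Rabs_mult, (Rabs_pos_eq c) by auto. apply Rmult_le_compat_l; [auto|apply HV; auto].
Qed.

Lemma solution_lipschitz n a b Rt M t tau :
  is_solution n a b Rt -> a < t -> 0 <= tau -> t + tau < b ->
  (forall s, t <= s <= t + tau -> tbound n M (Rt s)) ->
  tclose n (10 * INR n ^ 2 * M * M * tau) (Rt (t + tau)) (Rt t).
Proof.
  intros Hsol Ha Htau Hb HM i j k l Hi Hj Hk Hl.
  destruct Htau as [Htau|<-].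
  - destruct (MVT_cor2 (fun s => Rt s i j k l) (fun s => Qc n (Rt s) i j k l) t (t + tau)) as (c & Hc & Hct).
    + lra.
    + intros c Hc; apply Hsol; auto; lra.
    + cbv beta in Hc; rewrite Hc, Rabs_mult, (Rabs_pos_eq (t + tau - t)) by lra.
      replace (t + tau - t) with tau by ring.
      apply Rmult_le_compat_r; [lra|]. apply Qc_bound; auto. apply HM; lra.
  - rewrite Rplus_0_r, Rminus_diag, Rabs_R0; lra.
Qed.

(** By the mean value theorem each entry moves by tau times the entry of Q(Rt c), at a time c
    depending on the entry. The difference from Q(Rt t) is controlled by the Lipschitz constant 10
    n^2 M of Q and the Lipschitz constant 10 n^2 M^2 of the solution, whose product is the constant
    here. *)
Lemma solution_taylor n a b Rt M t tau :
  is_solution n a b Rt -> a < t -> 0 <= tau -> t + tau < b ->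
  (forall s, t <= s <= t + tau -> tbound n M (Rt s)) ->
  tclose n (100 * INR n ^ 4 * M ^ 3 * tau ^ 2) (Rt (t + tau)) (tadd (Rt t) (tscal tau (Qc n (Rt t)))).
Proof.
  intros Hsol Ha Htau Hb HM i j k l Hi Hj Hk Hl.
  assert (HM0 : 0 <= M).
  { eapply Rle_trans; [apply Rabs_pos | apply (HM t ltac:(lra) i j k l); auto]. }
  unfold tadd, tscal.
  destruct Htau as [Htau|<-].
  - destruct (MVT_cor2 (fun s => Rt s i j k l) (fun s => Qc n (Rt s) i j k l) t (t + tau)) as (c & Hc & Hct).
    + lra.
    + intros c Hc; apply Hsol; auto; lra.
    + cbv beta in Hc.
      replace (Rt (t + tau) i j k l - (Rt t i j k l + tau * Qc n (Rt t) i j k l)) with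
        (tau * (Qc n (Rt c) i j k l - Qc n (Rt t) i j k l)) by lra.
      rewrite Rabs_mult, (Rabs_pos_eq tau) by lra.
      assert (HL : tclose n (10 * INR n ^ 2 * M * M * (c - t)) (Rt c) (Rt t)).
      { replace c with (t + (c - t)) at 2 by ring.
        apply (solution_lipschitz n a b); auto; try lra. intros s Hs; apply HM; lra. }
      assert (HQ := Qc_lipschitz n M _ (Rt c) (Rt t) (HM c ltac:(lra)) (HM t ltac:(lra)) HL i j k l Hi Hj Hk Hl).
      replace (100 * INR n ^ 4 * M ^ 3 * tau ^ 2) with
        (tau * (10 * INR n ^ 2 * M * (10 * INR n ^ 2 * M * M * tau))) by ring.
      apply Rmult_le_compat_l; [lra|].
      eapply Rle_trans; [exact HQ|].
      assert (0 <= INR n ^ 2) by apply pow2_ge_0.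
      assert (Hn := pos_INR n).
      repeat apply Rmult_le_compat_l; try lra; repeat apply Rmult_le_pos; lra.
  - rewrite Rplus_0_r.
    replace (Rt t i j k l - (Rt t i j k l + 0 * Qc n (Rt t) i j k l)) with 0 by ring.
    rewrite Rabs_R0; apply Req_le; ring.
Qed.

(** Used once per index, it makes a bound that depends on four indices uniform. *)
Lemma uniform_bound_lt n (P : nat -> R -> Prop) :
  (forall i c c', c <= c' -> P i c -> P i c') ->
  (forall i, (i < n)%nat -> exists c, P i c) ->
  exists c, forall i, (i < n)%nat -> P i c.
Proof.
  intros Hm; induction n as [|n IH]; intros H.
  - exists 0; intros; lia.
  - destruct IH as [c Hc]; [auto with arith|].
    destruct (H n) as [c' Hc']; [lia|].
    exists (Rmax c c'); intros i Hi.
    destruct (Nat.eq_dec i n) as [->|].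
    + apply (Hm n c'); auto; apply Rmax_r.
    + apply (Hm i c); [apply Rmax_l|]; apply Hc; lia.
Qed.

Lemma solution_bounded n a b Rt T0 :
  is_solution n a b Rt -> a < 0 -> 0 <= T0 < b ->
  exists M, 0 < M /\ forall s, 0 <= s <= T0 -> tbound n M (Rt s).
Proof.
  intros Hsol Ha HT0.
  assert (Hone : forall4 n (fun i j k l => exists c, forall s, 0 <= s <= T0 -> Rabs (Rt s i j k l) <= c)).
  { intros i j k l Hi Hj Hk Hl.
    destruct (continuity_ab_maj (fun s => Rabs (Rt s i j k l)) 0 T0) as (m & Hm & _); [lra| |].
    - intros c Hc. apply (continuity_pt_comp (fun s => Rt s i j k l) Rabs); [|apply Rcontinuity_abs].
      apply derivable_continuous_pt. exists (Qc n (Rt c) i j k l). apply Hsol; auto; lra.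
    - eexists; exact Hm. }
  destruct (uniform_bound_lt n (fun i c => forall j k l, (j < n)%nat -> (k < n)%nat -> (l < n)%nat ->
     forall s, 0 <= s <= T0 -> Rabs (Rt s i j k l) <= c)) as [M HM].
  { intros i c c' Hc H; intros; eapply Rle_trans; [apply H|]; auto. }
  { intros i Hi.
    destruct (uniform_bound_lt n (fun j c => forall k l, (k < n)%nat -> (l < n)%nat ->
       forall s, 0 <= s <= T0 -> Rabs (Rt s i j k l) <= c)) as [M HM].
    { intros j c c' Hc H; intros; eapply Rle_trans; [apply H|]; auto. }
    { intros j Hj.
      destruct (uniform_bound_lt n (fun k c => forall l, (l < n)%nat ->
         forall s, 0 <= s <= T0 -> Rabs (Rt s i j k l) <= c)) as [M HM].
      { intros k c c' Hc H; intros; eapply Rle_trans; [apply H|]; auto. }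
      { intros k Hk.
        destruct (uniform_bound_lt n (fun l c => 
           forall s, 0 <= s <= T0 -> Rabs (Rt s i j k l) <= c)) as [M HM].
        { intros l c c' Hc H; intros; eapply Rle_trans; [apply H|]; auto. }
        { intros l Hl; now apply Hone. }
        exists M; intros; now apply HM. }
      exists M; intros; now apply HM. }
    exists M; intros; now apply HM. }
  exists (Rmax M 1); split; [apply Rlt_le_trans with 1; [lra|apply Rmax_r]|].
  intros s Hs i j k l Hi Hj Hk Hl; eapply Rle_trans; [|apply Rmax_l]; now apply HM.
Qed.

(** * Compactness and uniform transversality *)

(** Coquelicot states compactness of boxes for nested pairs; here the head of the pair is the
    coordinate of highest index. *)
Fixpoint to_Tn (N : nat) (x : nat -> R) : Compactness.Tn N R :=
  match N return Compactness.Tn N R with O => tt | S k => (x k, to_Tn k x) end.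
Fixpoint of_Tn (N : nat) : Compactness.Tn N R -> nat -> R :=
  match N return Compactness.Tn N R -> nat -> R with
  | O => fun _ _ => 0
  | S k => fun t i => if Nat.eqb i k then fst t else of_Tn k (snd t) i
  end.

Lemma of_to_Tn N x i : (i < N)%nat -> of_Tn N (to_Tn N x) i = x i.
Proof.
  induction N as [|N IH]; intros Hi; [lia|]; simpl.
  destruct (Nat.eqb_spec i N) as [->|]; [reflexivity|]. apply IH; lia.
Qed.

Lemma bounded_n_iff N lo hi t :
  Compactness.bounded_n N (to_Tn N lo) (to_Tn N hi) t <->
  forall i, (i < N)%nat -> lo i <= of_Tn N t i <= hi i.
Proof.
  induction N as [|N IH]; simpl; [split; [intros; lia|easy]|].
  destruct t as [a t]; rewrite IH; simpl; split.
  - intros [H1 H2] i Hi; destruct (Nat.eqb_spec i N) as [->|]; [assumption|]. apply H2; lia.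
  - intros H; split.
    + specialize (H N ltac:(lia)); now rewrite Nat.eqb_refl in H.
    + intros i Hi; specialize (H i ltac:(lia)).
      destruct (Nat.eqb_spec i N); [lia|assumption].
Qed.

Lemma close_n_elim N d s t :
  Compactness.close_n N d s t -> forall i, (i < N)%nat -> Rabs (of_Tn N s i - of_Tn N t i) < d.
Proof.
  induction N as [|N IH]; simpl; [intros; lia|].
  destruct s as [b s], t as [a t]; simpl.
  intros [H1 H2] i Hi; destruct (Nat.eqb_spec i N) as [->|]; [assumption|]. apply IH; auto; lia.
Qed.

(** Cousin's form of compactness: a gauge is chosen pointwise, and finitely many tags suffice, so
    their radii have a positive lower bound d. Since [P] is not assumed monotone in its radius, the
    conclusion keeps the tag's own radius [e] with [d <= e]. *)
Lemma box_gauge (N : nat) (lo hi : nat -> R) (P : (nat -> R) -> R -> Prop) :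
  (forall x, (forall i, (i < N)%nat -> lo i <= x i <= hi i) -> exists d, 0 < d /\ P x d) ->
  exists d, 0 < d /\ forall x, (forall i, (i < N)%nat -> lo i <= x i <= hi i) ->
    exists y e, (forall i, (i < N)%nat -> lo i <= y i <= hi i) /\ P y e /\ d <= e /\
      forall i, (i < N)%nat -> Rabs (x i - y i) < e.
Proof.
  intros HP.
  assert (Hg : forall t : Compactness.Tn N R, exists d : posreal,
    (forall i, (i < N)%nat -> lo i <= of_Tn N t i <= hi i) -> P (of_Tn N t) d).
  { intros t; destruct (classic (forall i, (i < N)%nat -> lo i <= of_Tn N t i <= hi i)) as [Ht|Ht].
    - destruct (HP _ Ht) as (d & Hd & HPd); exists (mkposreal d Hd); auto.
    - exists (mkposreal 1 Rlt_0_1); tauto. }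
  pose (g := fun t => proj1_sig (constructive_indefinite_description _ (Hg t))).
  assert (Hg' : forall t, (forall i, (i < N)%nat -> lo i <= of_Tn N t i <= hi i) -> P (of_Tn N t) (g t)).
  { intros t; exact (proj2_sig (constructive_indefinite_description _ (Hg t))). }
  destruct (Compactness.compactness_value N (to_Tn N lo) (to_Tn N hi) g) as [d Hd].
  exists d; split; [apply cond_pos|].
  intros x Hx.
  assert (Hb : Compactness.bounded_n N (to_Tn N lo) (to_Tn N hi) (to_Tn N x)).
  { apply bounded_n_iff; intros i Hi; rewrite of_to_Tn by auto; auto. }
  apply Hd, NNPP in Hb. destruct Hb as (t & Ht & Hc & Hdt).
  pose proof (proj1 (bounded_n_iff N lo hi t) Ht) as Hbox; clear Ht.
  exists (of_Tn N t), (g t); repeat split; auto; try (apply Hbox; auto).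
  intros i Hi. rewrite <- (of_to_Tn N x i) by auto. now apply close_n_elim.
Qed.

Lemma tensor_gauge (n : nat) (M lo hi : R) (P : tensor4 -> R -> R -> Prop) :
  (forall T b, tbound n M T -> lo <= b <= hi -> exists d, 0 < d /\ P T b d) ->
  exists d, 0 < d /\ forall T b, tbound n M T -> lo <= b <= hi ->
    exists T' b' e, tbound n M T' /\ lo <= b' <= hi /\ P T' b' e /\ d <= e /\
      tclose n e T T' /\ Rabs (b - b') <= e.
Proof.
  intros HP.
  (* A quadruple of indices is read as a number with four digits in base n. Coordinate N, one past
     the tensor, holds b, so the box has dimension [S N]. *)
  set (N := (n * n * n * n)%nat).
  set (dec := fun (x : nat -> R) i j k l => x (((i * n + j) * n + k) * n + l)%nat).
  assert (Hidx : forall i j k l, (i < n)%nat -> (j < n)%nat -> (k < n)%nat -> (l < n)%nat ->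
            (((i * n + j) * n + k) * n + l < N)%nat).
  { assert (Hs : forall a b m, (a < m)%nat -> (b < n)%nat -> (a * n + b < m * n)%nat) by (intros; nia).
    intros; unfold N; auto. }
  set (bnd := fun (s : R) (u v : R) m => if Nat.ltb m N then s * u else v).
  set (enc := fun (T : tensor4) (b : R) m =>
    if Nat.ltb m N then T (m / n / n / n)%nat ((m / n / n) mod n)%nat ((m / n) mod n)%nat (m mod n)%nat else b).
  assert (Hde : forall T b, teq n (dec (enc T b)) T).
  { intros T b i j k l Hi Hj Hk Hl; unfold dec, enc.
    assert (Hx := Hidx i j k l Hi Hj Hk Hl). apply Nat.ltb_lt in Hx; rewrite Hx.
    assert (Hdiv : forall a r, (r < n)%nat -> ((a * n + r) / n = a)%nat).
    { intros a r Hr; rewrite Nat.div_add_l, Nat.div_small by lia; lia. }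
    assert (Hmod : forall a r, (r < n)%nat -> ((a * n + r) mod n = r)%nat).
    { intros a r Hr; rewrite Nat.add_comm, Nat.Div0.mod_add; now apply Nat.mod_small. }
    rewrite !Hdiv, !Hmod by auto; reflexivity. }
  destruct (box_gauge (S N) (bnd (-1) M lo) (bnd 1 M hi) (fun x => P (dec x) (x N))) as (d & Hd & H).
  - intros x Hx. apply HP.
    + intros i j k l Hi Hj Hk Hl. unfold dec.
      assert (Hm := Hidx i j k l Hi Hj Hk Hl).
      specialize (Hx (((i * n + j) * n + k) * n + l)%nat ltac:(lia)); unfold bnd in Hx.
      apply Nat.ltb_lt in Hm; rewrite Hm in Hx. apply Rabs_le; lra.
    + specialize (Hx N ltac:(lia)); unfold bnd in Hx. rewrite Nat.ltb_irrefl in Hx; assumption.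
  - exists d; split; [assumption|]. intros T b HT Hb.
    destruct (H (enc T b)) as (y & e & Hy & HPy & Hde' & Hc).
    + intros m Hm; unfold bnd, enc. destruct (Nat.ltb_spec m N) as [HmN|]; [|assumption].
      assert (Hn : (n <> 0)%nat) by (intros ->; unfold N in HmN; lia).
      assert (Ht : Rabs (T (m / n / n / n)%nat ((m / n / n) mod n)%nat ((m / n) mod n)%nat (m mod n)%nat) <= M).
      { apply HT; try (apply Nat.mod_upper_bound; assumption).
        do 3 (apply Nat.Div0.div_lt_upper_bound). unfold N in HmN; lia. }
      apply Rabs_le_inv in Ht. lra.
    + exists (dec y), (y N), e; repeat split; auto.
      * intros i j k l Hi Hj Hk Hl. unfold dec.
        assert (Hm := Hidx i j k l Hi Hj Hk Hl).
        specialize (Hy (((i * n + j) * n + k) * n + l)%nat ltac:(lia)); unfold bnd in Hy.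
        apply Nat.ltb_lt in Hm; rewrite Hm in Hy. apply Rabs_le; lra.
      * specialize (Hy N ltac:(lia)); unfold bnd in Hy; rewrite Nat.ltb_irrefl in Hy; lra.
      * specialize (Hy N ltac:(lia)); unfold bnd in Hy; rewrite Nat.ltb_irrefl in Hy; lra.
      * intros i j k l Hi Hj Hk Hl.
        rewrite <- (Hde T b i j k l Hi Hj Hk Hl).
        apply Rlt_le, Hc. assert (Hm := Hidx i j k l Hi Hj Hk Hl); lia.
      * specialize (Hc N ltac:(lia)); unfold enc in Hc; rewrite Nat.ltb_irrefl in Hc; lra.
Qed.

(** * Cones in terms of the slope b, and quantitative transversality *)

Definition cone (n : nat) (theta b : R) : tset := fun T => exists h, splits n theta T h (b * h).

Lemma cone_add n theta b V W : cone n theta b V -> cone n theta b W -> cone n theta b (tadd V W).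
Proof.
  intros [h Hh] [h' Hh']; exists (h + h'); rewrite Rmult_plus_distr_l; now apply splits_add.
Qed.

Lemma cone_scal n theta b c V : 0 <= c -> cone n theta b V -> cone n theta b (tscal c V).
Proof.
  intros Hc [h Hh]; exists (c * h).
  replace (b * (c * h)) with (c * (b * h)) by ring; now apply splits_scal.
Qed.

Lemma cone_ext n theta b V W : teq n V W -> cone n theta b V -> cone n theta b W.
Proof. intros E [h Hh]; exists h; now apply (splits_ext n theta V). Qed.

Lemma cone_act n theta b V : cone n theta b V -> is_act n V.
Proof. intros [h Hh]; eapply splits_act; exact Hh. Qed.

(** The data produced by [splits_near_sphere], fixed once and for all: slope 1/(n-2) lies below
    every b in use, so one c and one rho serve all the cones. *)
Definition near_sphere (n : nat) (theta c rho : R) : Prop :=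
  0 < c /\ 0 < rho /\
  forall E, is_act n E -> tbound n rho E ->
    splits n theta (tadd (sphere c) E) (INR n) (/ (INR n - 2) * INR n).

Lemma splits_near_sphere_scal n theta c rho e E :
  near_sphere n theta c rho -> 0 < e -> is_act n E -> tbound n (e * rho) E ->
  splits n theta (tadd (tscal e (sphere c)) E) (e * INR n) (e * (/ (INR n - 2) * INR n)).
Proof.
  intros (Hc & Hrho & H) He HE Hb.
  apply (splits_ext n theta (tscal e (tadd (sphere c) (tscal (/ e) E)))).
  - intros i j k l _ _ _ _; unfold tscal, tadd; field; lra.
  - apply splits_scal; [lra|]. apply H; [now apply act_scal|].
    replace rho with (/ e * (e * rho)) by (field; lra).
    apply tbound_scal; [apply Rlt_le, Rinv_0_lt_compat; lra|assumption].
Qed.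

Lemma cone_near_sphere n theta c rho b e E :
  near_sphere n theta c rho -> / (INR n - 2) <= b -> 0 < e -> is_act n E -> tbound n (e * rho) E ->
  cone n theta b (tadd (tscal e (sphere c)) E).
Proof.
  intros HN Hb He HE HEb; exists (e * INR n).
  eapply splits_mono; [|now apply (splits_near_sphere_scal n theta c rho)].
  assert (Hn := pos_INR n).
  replace (e * (/ (INR n - 2) * INR n)) with (/ (INR n - 2) * (e * INR n)) by ring.
  apply Rmult_le_compat_r; [nra|assumption].
Qed.

Lemma cone_sphere n theta c rho b e :
  near_sphere n theta c rho -> / (INR n - 2) <= b -> 0 < e -> cone n theta b (tscal e (sphere c)).
Proof.
  intros HN Hb He.
  apply (cone_ext n theta b (tadd (tscal e (sphere c)) (tscal 0 (sphere c)))).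
  - intros i j k l _ _ _ _; unfold tadd, tscal; ring.
  - apply (cone_near_sphere n theta c rho); auto; [apply act_scal, sphere_act|].
    intros i j k l _ _ _ _; unfold tscal; rewrite Rmult_0_l, Rabs_R0.
    destruct HN as (_ & Hr & _); nra.
Qed.

Definition push (n : nat) (c t e : R) (T : tensor4) : tensor4 :=
  tadd (tadd (Qc n T) (tscal t T)) (tscal (- e) (sphere c)).

(* Raising the drift coefficient and lowering the sphere coefficient adds elements of
   the cone. *)
Lemma cone_push_weaken n theta c rho b t e t' e' T :
  near_sphere n theta c rho -> / (INR n - 2) <= b -> t <= t' -> e' < e ->
  cone n theta b T -> cone n theta b (push n c t e T) -> cone n theta b (push n c t' e' T).
Proof.
  intros HN Hb Ht He HT HP.
  apply (cone_ext n theta b (tadd (push n c t e T) (tadd (tscal (t' - t) T) (tscal (e - e') (sphere c))))).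
  - intros i j k l _ _ _ _; unfold push, tadd, tscal; ring.
  - apply cone_add; [assumption|]. apply cone_add.
    + apply cone_scal; [lra|assumption].
    + apply (cone_sphere n theta c rho); auto; lra.
Qed.

(* The tangent cone at T is the closure of cone + R T, so an interior point of it stays
   in cone + R T after subtracting a small interior point of the cone. *)
Lemma transversal_push n sigma theta c rho T :
  (5 <= n)%nat -> near_sphere n theta c rho -> 1 < sigma < 2 ->
  transversally_invariant_away0 n (cone_C n sigma theta) ->
  is_act n T -> in_closure n (cone_C n sigma theta) T -> Defs.nonzero n T ->
  exists t e, 0 <= t /\ 0 < e /\ cone n theta (/ (INR n - 2 * sigma)) (push n c t e T).
Proof.
  intros Hn5 HN Hsig Htr HT Hcl Hnz.
  assert (HNn : 5 <= INR n) by (apply (le_INR 5) in Hn5; simpl in Hn5; lra).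
  assert (Hs : 0 < INR n - 2 * sigma) by lra.
  set (b := / (INR n - 2 * sigma)).
  assert (Hb : / (INR n - 2) <= b) by (apply Rinv_le_contravar; lra).
  destruct (classic (in_interior n (cone_C n sigma theta) T)) as [Hint|Hnint].
  - destruct Hint as (eps & Heps & Hint).
    destruct (tdist2_of_tclose n eps ltac:(lia) Heps) as (e & He & Hclose).
    set (Z := tadd (Qc n T) (tscal (-1) (sphere c))).
    assert (HZ : is_act n Z) by (apply act_add; [now apply Qc_act|apply act_scal, sphere_act]).
    assert (HB := nrm_bound n Z). assert (HB0 := nrm_nonneg n Z).
    (* T is interior, so a large drift suffices: Z / t has entries below e. *)
    set (t := (nrm n Z + 1) / e).
    assert (Ht : 0 < t) by (apply Rdiv_lt_0_compat; lra).
    exists t, 1; split; [lra|]; split; [lra|].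
    apply (cone_ext n theta b (tscal t (tadd T (tscal (/ t) Z)))).
    + intros i j k l _ _ _ _; unfold push, Z, tadd, tscal; field; lra.
    + apply cone_scal; [lra|]. apply cone_C_splits; [assumption|].
      apply Hint; [apply act_add; [assumption|now apply act_scal]|].
      apply Hclose. intros i j k l Hi Hj Hk Hl; unfold tadd, tscal.
      replace (T i j k l - (T i j k l + / t * Z i j k l)) with (- (/ t * Z i j k l)) by ring.
      rewrite Rabs_Ropp, Rabs_mult, (Rabs_pos_eq (/ t)) by (apply Rlt_le, Rinv_0_lt_compat; lra).
      specialize (HB i j k l Hi Hj Hk Hl).
      apply (Rmult_le_reg_l t); [lra|]. rewrite <- Rmult_assoc, Rinv_r, Rmult_1_l by lra.
      replace (t * e) with (nrm n Z + 1) by (unfold t; field; lra). lra.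
  - destruct (Htr T HT (conj Hcl Hnint) Hnz) as (eps & Heps & Hint).
    destruct (tdist2_of_tclose n eps ltac:(lia) Heps) as (d & Hd & Hclose).
    assert (Hc : 0 < c) by apply HN. assert (Hrho : 0 < rho) by apply HN.
    (* Entries of [sphere c] are at most 4 c, so subtracting e times the sphere moves Q(T) by at
       most d. *)
    set (e := d / (4 * c)).
    assert (He : 0 < e) by (apply Rdiv_lt_0_compat; lra).
    set (W := tadd (Qc n T) (tscal (- e) (sphere c))).
    assert (HW : is_act n W) by (apply act_add; [now apply Qc_act|apply act_scal, sphere_act]).
    assert (HtW : tangent_cone n (cone_C n sigma theta) T W).
    { apply Hint; [assumption|]. apply Hclose. intros i j k l Hi Hj Hk Hl; unfold W, tadd, tscal.
      replace (Qc n T i j k l - (Qc n T i j k l + - e * sphere c i j k l)) with (e * sphere c i j k l) by ring.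
      rewrite Rabs_mult, (Rabs_pos_eq e) by lra.
      assert (Hsb := sphere_bound n c ltac:(lra) i j k l Hi Hj Hk Hl).
      replace d with (e * (4 * c)) by (unfold e; field; lra).
      apply Rmult_le_compat_l; lra. }
    (* The tangent cone is a closure, so only a nearby V is of the form t (X - T). Half of the
       subtracted sphere is given back to absorb W - V. *)
    destruct (HtW ((e / 2 * rho) ^ 2)) as (V & (t & X & Ht & HX & HV) & HWV).
    { apply pow_lt, Rmult_lt_0_compat; lra. }
    apply tclose_of_tdist2 in HWV; [|apply Rmult_le_pos; lra].
    exists t, (e / 2); split; [assumption|]; split; [lra|].
    apply cone_C_splits in HX; [|assumption].
    assert (HVact : is_act n V).
    { apply (act_ext n (tscal t (tadd X (tscal (-1) T)))).
      - intros i j k l Hi Hj Hk Hl; rewrite HV by auto; unfold tscal, tadd; ring.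
      - apply act_scal, act_add; [now apply (cone_act n theta b)|now apply act_scal]. }
    apply (cone_ext n theta b (tadd (tscal t X) (tadd (tscal (e / 2) (sphere c)) (tadd W (tscal (-1) V))))).
    + intros i j k l Hi Hj Hk Hl; unfold push, W, tadd, tscal; rewrite HV by auto; field.
    + apply cone_add; [now apply cone_scal|].
      apply (cone_near_sphere n theta c rho); auto; [lra| |].
      * apply act_add; [assumption|now apply act_scal].
      * intros i j k l Hi Hj Hk Hl; unfold tadd, tscal.
        replace (W i j k l + -1 * V i j k l) with (W i j k l - V i j k l) by ring. now apply HWV.
Qed.

(** [splits_trace_le] and |scal| <= n^2 c give 2 (n - 1) h <= n^2 c, and n <= 2 (n - 1). *)
Lemma splits_trace_bound n theta T h L c : (5 <= n)%nat ->
  splits n theta T h L -> tbound n c T -> h <= INR n * c.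
Proof.
  intros Hn HT Hb.
  assert (HNn : 5 <= INR n) by (apply (le_INR 5) in Hn; simpl in Hn; lra).
  assert (H1 := splits_trace_le n theta T h L HT).
  assert (H2 := scal_bound n c T Hb). apply Rabs_le_inv in H2.
  assert (0 <= c) by (eapply Rle_trans; [apply Rabs_pos | apply (Hb 0 0 0 0)%nat; lia]).
  destruct (Rle_lt_dec h 0) as [Hh|Hh]; [apply Rle_trans with 0; [lra|apply Rmult_le_pos; lra]|].
  apply (Rmult_le_reg_l (INR n)); [lra|]. nra.
Qed.

Lemma eq_0_of_small x k : (forall e, 0 < e -> Rabs x <= k * e) -> x = 0.
Proof.
  intros H. destruct (Req_dec x 0) as [|Hx]; [assumption|exfalso].
  assert (Hp := Rabs_pos_lt x Hx).
  assert (Hk : 0 < k) by (specialize (H 1 Rlt_0_1); lra).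
  specialize (H (Rabs x / (2 * k)) ltac:(apply Rdiv_lt_0_compat; lra)).
  replace (k * (Rabs x / (2 * k))) with (Rabs x / 2) in H by (field; lra). lra.
Qed.

Lemma act_limit n T :
  (forall e, 0 < e -> exists T', is_act n T' /\ tclose n e T' T) -> is_act n T.
Proof.
  intros H i j k l Hi Hj Hk Hl.
  repeat split; apply Rminus_diag_uniq; apply (eq_0_of_small _ 3); intros e He;
    destruct (H e He) as (T' & HT' & Hc);
    destruct (HT' i j k l Hi Hj Hk Hl) as (e1 & e2 & e3).
  - assert (c1 := Rabs_le_inv _ _ (Hc i j k l Hi Hj Hk Hl)).
    assert (c2 := Rabs_le_inv _ _ (Hc j i k l Hj Hi Hk Hl)).
    apply Rabs_le; lra.
  - assert (c1 := Rabs_le_inv _ _ (Hc i j k l Hi Hj Hk Hl)).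
    assert (c2 := Rabs_le_inv _ _ (Hc k l i j Hk Hl Hi Hj)).
    apply Rabs_le; lra.
  - assert (c1 := Rabs_le_inv _ _ (Hc i j k l Hi Hj Hk Hl)).
    assert (c2 := Rabs_le_inv _ _ (Hc j k i l Hj Hk Hi Hl)).
    assert (c3 := Rabs_le_inv _ _ (Hc k i j l Hk Hi Hj Hl)).
    apply Rabs_le; lra.
Qed.

Lemma exists_small (l : list R) :
  (forall x, List.In x l -> 0 < x) -> exists d, 0 < d /\ forall x, List.In x l -> d <= x.
Proof.
  induction l as [|a l IH]; intros H.
  - exists 1; split; [lra|easy].
  - destruct IH as (d & Hd & Hl); [intros; apply H; now right|].
    exists (Rmin a d); split; [apply Rmin_pos; [apply H; now left|assumption]|].
    intros x [<-|Hx]; [apply Rmin_l|]. eapply Rle_trans; [apply Rmin_r|auto].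
Qed.

(** If T is a limit of normalised elements of cones with slopes tending to b, then T is nonzero and
    in the closure of the cone of slope b, so [transversal_push] applies at T, and half of its gain
    e P pays for passing from (T, b) to (T', b'). Otherwise some neighbourhood contains no such
    elements and the claim there is vacuous. *)
Lemma push_gauge n theta c rho b1 b0 T b :
  (5 <= n)%nat -> 0 <= theta -> near_sphere n theta c rho ->
  (forall sigma, 1 < sigma < 2 -> transversally_invariant_away0 n (cone_C n sigma theta)) ->
  / (INR n - 2) < b1 -> b0 < / (INR n - 4) ->
  tbound n 1 T -> b1 <= b <= b0 ->
  exists d, 0 < d /\ forall T' b', tclose n d T' T -> Rabs (b' - b) <= d -> b1 <= b' <= b0 ->
    nrm n T' = 1 -> cone n theta b' T' -> cone n theta b' (push n c (/ d) d T').
Proof.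
  intros Hn5 Hth HN Htr Hb1 Hb0 HT Hb.
  assert (HNn : 5 <= INR n) by (apply (le_INR 5) in Hn5; simpl in Hn5; lra).
  assert (Hi2 : 0 < / (INR n - 2)) by (apply Rinv_0_lt_compat; lra).
  assert (HN4 : 0 < INR n ^ 4) by (apply pow_lt; lra).
  assert (Hc : 0 < c) by apply HN. assert (Hrho : 0 < rho) by apply HN.
  destruct (classic (forall e, 0 < e -> exists T' b', tclose n e T' T /\ Rabs (b' - b) <= e /\
      b1 <= b' <= b0 /\ nrm n T' = 1 /\ cone n theta b' T')) as [Hacc|Hacc].
  2:{ apply not_all_ex_not in Hacc; destruct Hacc as [e He].
      apply imply_to_and in He; destruct He as [He Hno].
      exists e; split; [assumption|]. intros T' b' H1 H2 H3 H4 H5; exfalso; apply Hno.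
      exists T', b'; auto. }
  assert (HTact : is_act n T).
  { apply act_limit; intros e He; destruct (Hacc e He) as (T' & b' & H1 & _ & _ & _ & H2).
    exists T'; split; [now apply (cone_act n theta b')|assumption]. }
  assert (Hnz : Defs.nonzero n T).
  { apply NNPP; intros Hno.
    (* Entries within 1/(2 n^4) change the norm by at most 1/2, so T = 0 is incompatible with norm 1
       nearby. *)
    destruct (Hacc (/ (2 * INR n ^ 4))) as (T' & b' & H1 & _ & _ & H2 & _).
    { apply Rinv_0_lt_compat; lra. }
    assert (H3 := nrm_close n _ _ _ H1).
    assert (H4 : nrm n T <= INR n ^ 4 * 0).
    { apply nrm_le; intros i j k l Hi Hj Hk Hl.
      destruct (Req_dec (T i j k l) 0) as [->|Hx]; [rewrite Rabs_R0; lra|].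
      exfalso; apply Hno; exists i, j, k, l; auto. }
    replace (INR n ^ 4 * / (2 * INR n ^ 4)) with (/ 2) in H3 by (field; lra). lra. }
  (* Solves b = 1/(n - 2 sigma); the bounds on b1 and b0 place sigma strictly between 1 and 2. *)
  set (sigma := (INR n - / b) / 2).
  assert (Hbs : / (INR n - 2 * sigma) = b) by (unfold sigma; field; lra).
  assert (Hsig : 1 < sigma < 2).
  { assert (/ b < INR n - 2) by (rewrite <- (Rinv_inv (INR n - 2)); apply Rinv_lt_contravar; nra).
    assert (INR n - 4 < / b) by (rewrite <- (Rinv_inv (INR n - 4)); apply Rinv_lt_contravar; nra).
    unfold sigma; lra. }
  assert (Hcl : in_closure n (cone_C n sigma theta) T).
  { intros eps Heps. destruct (tdist2_of_tclose n eps ltac:(lia) Heps) as (d & Hd & Hclose).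
    (* T' has slope b', possibly above b. Adding k P, of slope 1/(n-2) only, creates a slack of at
       least k n (b1 - 1/(n-2)), which covers the excess e h because h <= n. The sphere and T' - T
       each use half of d. *)
    set (k := d / (8 * c)).
    assert (Hk : 0 < k) by (apply Rdiv_lt_0_compat; lra).
    assert (Hd2 : 0 < k * (b1 - / (INR n - 2))) by nra.
    destruct (exists_small (cons (d / 2) (cons (k * (b1 - / (INR n - 2))) nil))) as (e & He & Hel).
    { intros x [<-|[<-|[]]]; lra. }
    destruct (Hacc e He) as (T' & b' & H1 & H2 & H3 & H4 & (h & H5)).
    assert (He1 : e <= d / 2) by (apply Hel; simpl; auto).
    assert (He2 : e <= k * (b1 - / (INR n - 2))) by (apply Hel; simpl; auto).
    exists (tadd T' (tscal k (sphere c))); split.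
    - apply cone_C_splits; [lra|]. rewrite Hbs.
      assert (Hs : splits n theta (tscal k (sphere c)) (k * INR n) (k * (/ (INR n - 2) * INR n))).
      { apply (splits_ext n theta (tadd (tscal k (sphere c)) (tscal 0 (sphere c)))).
        - intros i j k' l _ _ _ _; unfold tadd, tscal; ring.
        - apply (splits_near_sphere_scal n theta c rho); auto; [apply act_scal, sphere_act|].
          intros i j k' l _ _ _ _; unfold tscal; rewrite Rmult_0_l, Rabs_R0; nra. }
      exists (h + k * INR n).
      eapply splits_mono; [|exact (splits_add _ _ _ _ _ _ _ _ H5 Hs)].
      assert (Hh0 := splits_trace_nonneg n theta _ _ _ Hth H5).
      assert (Hh1 : h <= INR n * 1).
      { apply (splits_trace_bound n theta T' h (b' * h)); auto. rewrite <- H4; apply nrm_bound. }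
      apply Rabs_le_inv in H2.
      assert (b' * h <= b * h + e * h) by nra.
      assert (e * h <= k * (b1 - / (INR n - 2)) * INR n) by nra.
      assert (k * (b1 - / (INR n - 2)) * INR n <= k * (b - / (INR n - 2)) * INR n).
      { apply Rmult_le_compat_r; [lra|]. apply Rmult_le_compat_l; lra. }
      lra.
    - apply Hclose. intros i j k' l Hi Hj Hk' Hl. unfold tadd, tscal.
      assert (c1 := Rabs_le_inv _ _ (H1 i j k' l Hi Hj Hk' Hl)).
      assert (c2 := Rabs_le_inv _ _ (tbound_scal n k _ _ ltac:(lra) (sphere_bound n c ltac:(lra)) i j k' l Hi Hj Hk' Hl)).
      unfold tscal in c2. replace (k * (4 * c)) with (d / 2) in c2 by (unfold k; field; lra).
      apply Rabs_le; lra. }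
  destruct (transversal_push n sigma theta c rho T Hn5 HN Hsig (Htr sigma Hsig) HTact Hcl Hnz)
    as (t & e & Ht & He & (h & Hpush)).
  rewrite Hbs in Hpush.
  assert (Hh0 := splits_trace_nonneg n theta _ _ _ Hth Hpush).
  set (A := 10 * INR n ^ 2 + t).
  assert (HA : 0 < A) by (unfold A; nra).
  assert (HgA : 0 < e / 2 * INR n * (b1 - / (INR n - 2))) by (repeat apply Rmult_lt_0_compat; lra).
  (* The four bounds give in turn d < e/2, t <= 1/d, entries of the perturbation E within (e/2) rho,
     and a cost d h of changing b into b' that is covered by the gain of (e/2) P. *)
  destruct (exists_small (cons (e / 4) (cons (/ (t + 1)) (cons (e / 2 * rho / A)
     (cons (e / 2 * INR n * (b1 - / (INR n - 2)) / (h + 1)) nil))))) as (d & Hd & Hdl).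
  { intros x [<-|[<-|[<-|[<-|[]]]]]; try lra.
    - apply Rinv_0_lt_compat; lra.
    - apply Rdiv_lt_0_compat; [apply Rmult_lt_0_compat|]; lra.
    - apply Rdiv_lt_0_compat; lra. }
  assert (Hd1 : d <= e / 4) by (apply Hdl; simpl; auto).
  assert (Hd2 : d <= / (t + 1)) by (apply Hdl; simpl; auto).
  assert (Hd3 : d * A <= e / 2 * rho).
  { apply Rle_trans with (e / 2 * rho / A * A); [|apply Req_le; field; lra].
    apply Rmult_le_compat_r; [lra|]. apply Hdl; simpl; auto. }
  assert (Hd4 : d * (h + 1) <= e / 2 * INR n * (b1 - / (INR n - 2))).
  { apply Rle_trans with (e / 2 * INR n * (b1 - / (INR n - 2)) / (h + 1) * (h + 1)); [|apply Req_le; field; lra].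
    apply Rmult_le_compat_r; [lra|]. apply Hdl; simpl; auto. }
  exists d; split; [assumption|].
  intros T' b' H1 H2 H3 H4 H5.
  assert (HT' : tbound n 1 T') by (rewrite <- H4; apply nrm_bound).
  apply (cone_push_weaken n theta c rho b' t (e / 2)); auto; try lra.
  (* The drift t may be 0, in which case its double inverse is 0 by convention. *)
  { rewrite <- (Rinv_inv t). destruct (Req_dec t 0) as [->|Ht0].
    - rewrite !Rinv_0. apply Rlt_le, Rinv_0_lt_compat; lra.
    - apply Rinv_le_contravar; [lra|]. eapply Rle_trans; [exact Hd2|]. apply Rinv_le_contravar; lra. }
  set (E := tadd (tadd (Qc n T') (tscal (-1) (Qc n T))) (tscal t (tadd T' (tscal (-1) T)))).
  assert (HE : is_act n E).
  { assert (is_act n T') by now apply (cone_act n theta b').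
    apply act_add; [apply act_add; [|apply act_scal]; now apply Qc_act|].
    apply act_scal, act_add; [assumption|now apply act_scal]. }
  assert (HEb : tbound n (e / 2 * rho) E).
  { intros i j k l Hi Hj Hk Hl. unfold E, tadd, tscal.
    assert (c1 := Rabs_le_inv _ _ (H1 i j k l Hi Hj Hk Hl)).
    assert (c2 := Rabs_le_inv _ _ (Qc_lipschitz n 1 d T' T HT' HT H1 i j k l Hi Hj Hk Hl)).
    assert (- (t * d) <= t * (T' i j k l + -1 * T i j k l) <= t * d) by (split; nra).
    apply Rabs_le; unfold A in Hd3; split; nra. }
  assert (Hs := splits_near_sphere_scal n theta c rho (e / 2) E HN ltac:(lra) HE HEb).
  exists (h + e / 2 * INR n).
  apply (splits_ext n theta (tadd (push n c t e T) (tadd (tscal (e / 2) (sphere c)) E))).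
  { intros i j k l _ _ _ _; unfold push, E, tadd, tscal; field. }
  eapply splits_mono; [|exact (splits_add _ _ _ _ _ _ _ _ Hpush Hs)].
  apply Rabs_le_inv in H2.
  assert (b * h <= b' * h + d * h) by nra.
  assert (e / 2 * INR n * (b1 - / (INR n - 2)) <= e / 2 * INR n * (b' - / (INR n - 2))).
  { apply Rmult_le_compat_l; [apply Rmult_le_pos|]; lra. }
  lra.
Qed.

(** On norm 1 the gauge yields one d for all T and all b in the interval. Q is quadratic, so passing
    to norm mu multiplies the drift by mu and the sphere coefficient by mu^2. *)
Lemma uniform_push n theta c rho b1 b0 :
  (5 <= n)%nat -> 0 <= theta -> near_sphere n theta c rho ->
  (forall sigma, 1 < sigma < 2 -> transversally_invariant_away0 n (cone_C n sigma theta)) ->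
  / (INR n - 2) < b1 -> b0 < / (INR n - 4) ->
  exists d, 0 < d <= 1 /\ forall T b, b1 <= b <= b0 -> cone n theta b T -> 0 < nrm n T ->
    cone n theta b (push n c (nrm n T / d) (d * nrm n T ^ 2) T).
Proof.
  intros Hn5 Hth HN Htr Hb1 Hb0.
  destruct (tensor_gauge n 1 b1 b0 (fun T b d => forall T' b', tclose n d T' T -> Rabs (b' - b) <= d ->
    b1 <= b' <= b0 -> nrm n T' = 1 -> cone n theta b' T' -> cone n theta b' (push n c (/ d) d T')))
    as (d0 & Hd0 & H).
  { intros T b HT Hb. now apply (push_gauge n theta c rho b1 b0). }
  (* Halved because [cone_push_weaken] lowers the sphere coefficient strictly, whereas the gauge
     only gives e >= d0. *)
  set (d := Rmin d0 1 / 2).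
  assert (Hm : 0 < Rmin d0 1) by (apply Rmin_pos; lra).
  assert (Hm1 := Rmin_l d0 1). assert (Hm2 := Rmin_r d0 1).
  exists d; split; [unfold d; lra|].
  intros T b Hb HT Hmu. set (mu := nrm n T) in *.
  set (U := tscal (/ mu) T).
  assert (Himu : 0 < / mu) by now apply Rinv_0_lt_compat.
  assert (HU1 : nrm n U = 1) by (unfold U; rewrite nrm_scal by lra; fold mu; field; lra).
  assert (HU : cone n theta b U) by (apply cone_scal; [lra|assumption]).
  destruct (H U b) as (T0 & b' & e & _ & _ & Hg & Hde & Hcl & Hbb); [rewrite <- HU1; apply nrm_bound|assumption|].
  assert (Hp : cone n theta b (push n c (/ d) d U)).
  { apply (cone_push_weaken n theta c rho b (/ e) e); auto; try (unfold d; lra).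
    apply Rinv_le_contravar; unfold d; lra. }
  apply (cone_ext n theta b (tscal (mu ^ 2) (push n c (/ d) d U))).
  - intros i j k l _ _ _ _; unfold push, tadd, tscal at 1 2 3; unfold U.
    rewrite Qc_scal. unfold tscal. field. unfold d; lra.
  - apply cone_scal; [apply pow2_ge_0|assumption].
Qed.

(** * The pinching function and its invariance *)

(** The admissible d for m remain admissible for larger m, so their supremum is monotone. It may not
    be attained, but half of it is admissible by downward closure. *)
Lemma monotone_choice (bi b0 : R) (P : R -> R -> Prop) :
  (forall m, bi < m <= b0 -> exists d, 0 < d <= 1 /\ P m d) ->
  (forall m d d', bi < m <= b0 -> 0 < d' < d -> P m d -> P m d') ->
  (forall m m' d, bi < m -> m <= m' -> P m d -> P m' d) ->
  exists g : R -> R,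
    (forall m, bi < m <= b0 -> 0 < g m <= 1 /\ P m (g m)) /\
    (forall m m', bi < m -> m <= m' -> m' <= b0 -> g m <= g m').
Proof.
  intros Hex Hdown Hmon.
  set (E := fun m d => 0 < d <= 1 /\ P m d).
  assert (Hlub : forall m, exists s, bi < m <= b0 -> is_lub (E m) s).
  { intros m; destruct (classic (bi < m <= b0)) as [Hm|Hm]; [|exists 0; tauto].
    destruct (completeness (E m)) as [s Hs].
    - exists 1; intros d [Hd _]; lra.
    - exact (Hex m Hm).
    - exists s; auto. }
  pose (s := fun m => proj1_sig (constructive_indefinite_description _ (Hlub m))).
  assert (Hs : forall m, bi < m <= b0 -> is_lub (E m) (s m)).
  { intros m; exact (proj2_sig (constructive_indefinite_description _ (Hlub m))). }
  exists (fun m => s m / 2); split.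
  - intros m Hm. destruct (Hs m Hm) as [Hub Hleast].
    destruct (Hex m Hm) as (d0 & Hd0 & HP0).
    assert (d0 <= s m) by (apply Hub; split; assumption).
    assert (s m <= 1) by (apply Hleast; intros d [Hd _]; lra).
    split; [lra|].
    apply NNPP; intros Hno.
    assert (s m <= s m / 2); [|lra].
    apply Hleast; intros d [Hd HPd]. apply Rnot_lt_le; intros Hlt; apply Hno.
    apply (Hdown m d); auto; lra.
  - intros m m' Hm Hmm Hm'.
    assert (s m <= s m'); [|lra].
    apply (Hs m ltac:(lra)); intros d [Hd HPd]. apply (Hs m' ltac:(lra)); split; [assumption|].
    apply (Hmon m); auto; lra.
Qed.

(* f is the lower envelope of the lines [a m + m s]. The intercepts
   [a m = exp (2 (b0 - m) / eta m) - 1] satisfy [a m >= 2 a (m + eta m / 2) + 1], so the line of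
   slope m comes within 1 of the envelope at s only where [f s / s <= m + eta m]. *)
Lemma concave_profile (bi b0 : R) (eta : R -> R) :
  0 < bi < b0 ->
  (forall m, bi < m <= b0 -> 0 < eta m) ->
  (forall m m', bi < m -> m <= m' -> m' <= b0 -> eta m <= eta m') ->
  exists f a : R -> R,
    (forall m, bi < m <= b0 -> 0 <= a m) /\
    (forall s m, 0 <= s -> bi < m <= b0 -> f s <= a m + m * s) /\
    (forall s v, 0 <= s -> (forall m, bi < m <= b0 -> v <= a m + m * s) -> v <= f s) /\
    (forall s, 0 <= s -> f s <= b0 * s) /\
    (exists d, 0 < d /\ forall s, 0 <= s < d -> f s = b0 * s) /\
    (forall M, 0 < M -> exists b1, bi < b1 <= b0 /\ forall s, 0 <= s <= M -> b1 * s <= f s) /\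
    (forall s b m, 0 <= s -> b <= b0 -> bi < m <= b0 -> f s = b * s ->
       f s + 1 <= a m + m * s \/ b <= m + eta m).
Proof.
  intros Hb Heta Hmon.
  set (K := fun m => 2 * (b0 - m) / eta m).
  set (a := fun m => exp (K m) - 1).
  assert (HK0 : forall m, bi < m <= b0 -> 0 <= K m).
  { intros m Hm; unfold K; apply Rmult_le_pos; [lra|]. apply Rlt_le, Rinv_0_lt_compat, Heta, Hm. }
  assert (HaK : forall m, K m <= a m).
  { intros m; unfold a. destruct (Req_dec (K m) 0) as [->|HK]; [rewrite exp_0; lra|].
    assert (H := exp_ineq1 (K m) HK); lra. }
  assert (Ha0 : forall m, bi < m <= b0 -> 0 <= a m).
  { intros m Hm; eapply Rle_trans; [apply HK0, Hm|apply HaK]. }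
  assert (Hdiv : forall x y m m', 0 <= y -> y <= x -> bi < m -> m <= m' -> m' <= b0 ->
             2 * y / eta m' <= 2 * x / eta m).
  { intros x y m m' Hy Hxy Hm Hmm Hm'. unfold Rdiv.
    assert (He := Heta m ltac:(lra)).
    apply Rmult_le_compat; [lra| |lra|].
    - apply Rlt_le, Rinv_0_lt_compat, Heta; lra.
    - apply Rinv_le_contravar; auto. }
  assert (Hamon : forall m m', bi < m -> m <= m' -> m' <= b0 -> a m' <= a m).
  { intros m m' Hm Hmm Hm'. unfold a.
    assert (HK : K m' <= K m) by (apply Hdiv; lra).
    destruct HK as [HK| ->]; [apply exp_increasing in HK|]; lra. }
  assert (Hab0 : a b0 = 0).
  { unfold a, K. replace (2 * (b0 - b0) / eta b0) with 0 by (unfold Rdiv; ring). rewrite exp_0; ring. }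
  assert (Hinf : forall s, exists v, 0 <= s ->
     (forall m, bi < m <= b0 -> v <= a m + m * s) /\
     (forall w, (forall m, bi < m <= b0 -> w <= a m + m * s) -> w <= v)).
  { intros s; destruct (Rle_lt_dec 0 s) as [Hs|Hs]; [|exists 0; lra].
    (* The infimum of the lines at s, taken as the supremum of their lower bounds: 0 is one of them,
       and the line of slope b0, with intercept 0, bounds them above. *)
    destruct (completeness (fun w => forall m, bi < m <= b0 -> w <= a m + m * s)) as [v [Hv1 Hv2]].
    - exists (b0 * s); intros w Hw. specialize (Hw b0 ltac:(lra)). lra.
    - exists 0; intros m Hm. assert (H := Ha0 m Hm). nra.
    - exists v; intros _; split.
      + intros m Hm; apply Hv2; intros w Hw; now apply Hw.
      + exact Hv1. }
  pose (f := fun s => proj1_sig (constructive_indefinite_description _ (Hinf s))).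
  assert (Hf := fun s => proj2_sig (constructive_indefinite_description _ (Hinf s))).
  assert (Hf1 : forall s m, 0 <= s -> bi < m <= b0 -> f s <= a m + m * s).
  { intros s m Hs; now apply (Hf s). }
  assert (Hf2 : forall s v, 0 <= s -> (forall m, bi < m <= b0 -> v <= a m + m * s) -> v <= f s).
  { intros s v Hs; now apply (Hf s). }
  clearbody f; clear Hf Hinf.
  assert (Hfb0 : forall s, 0 <= s -> f s <= b0 * s).
  { intros s Hs. assert (H := Hf1 s b0 Hs ltac:(lra)); lra. }
  exists f, a; repeat (split; [assumption|]). split; [|split].
  - assert (He0 := Heta b0 ltac:(lra)).
    (* Below this s the line of slope b0 is the lowest, since a m >= K m >= 2 (b0 - m) / eta b0 by
       monotonicity of eta. *)
    exists (2 / eta b0); split; [apply Rdiv_lt_0_compat; lra|].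
    intros s Hs; apply Rle_antisym; [apply Hfb0; lra|].
    apply Hf2; [lra|]. intros m Hm.
    assert (H1 : 2 * (b0 - m) / eta b0 <= K m) by (apply Hdiv; lra).
    assert (H2 := HaK m).
    assert (H3 : (b0 - m) * s <= 2 * (b0 - m) / eta b0).
    { replace (2 * (b0 - m) / eta b0) with ((b0 - m) * (2 / eta b0)) by (field; lra).
      apply Rmult_le_compat_l; lra. }
    lra.
  - intros M HM. set (m0 := (bi + b0) / 2).
    assert (Hm0 : bi < m0 <= b0) by (unfold m0; lra).
    assert (HA : 0 < a m0).
    { eapply Rlt_le_trans; [|apply HaK]. apply Rdiv_lt_0_compat; [unfold m0; lra|now apply Heta]. }
    assert (HAM : 0 < a m0 / M) by (apply Rdiv_lt_0_compat; lra).
    (* Lines of slope at least m0 need no intercept. The others have intercept at least a m0, which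
       for s <= M is worth an additional slope a m0 / M. *)
    exists (Rmin m0 (bi + a m0 / M)); split.
    + split; [apply Rmin_glb_lt; lra|]. eapply Rle_trans; [apply Rmin_l|lra].
    + intros s Hs; apply Hf2; [lra|]. intros m Hm.
      destruct (Rle_lt_dec m0 m) as [Hmm|Hmm].
      * assert (H1 := Rmin_l m0 (bi + a m0 / M)). assert (H2 := Ha0 m Hm). nra.
      * assert (H1 := Rmin_r m0 (bi + a m0 / M)).
        assert (H2 := Hamon m m0 ltac:(lra) ltac:(lra) ltac:(lra)).
        assert (H3 : a m0 / M * s <= a m0).
        { apply Rle_trans with (a m0 / M * M); [apply Rmult_le_compat_l; lra|].
          apply Req_le; field; lra. }
        assert (Rmin m0 (bi + a m0 / M) * s <= (bi + a m0 / M) * s) by (apply Rmult_le_compat_r; lra).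
        assert (bi * s <= m * s) by (apply Rmult_le_compat_r; lra). lra.
  - intros s b m Hs Hbb Hm Hfs.
    assert (He := Heta m Hm).
    destruct (Rle_lt_dec (f s + 1) (a m + m * s)) as [|Hlt]; [now left|right].
    (* Compare with the line of slope m' = m + eta m / 2. Being within 1 of the envelope forces a m'
       < (eta m / 2) s, hence f s < (m + eta m) s. If m' exceeds b0, then b <= b0 is enough. *)
    destruct (Rle_lt_dec (m + eta m / 2) b0) as [Hm'|]; [|lra].
    set (m' := m + eta m / 2) in *.
    assert (Hm'2 : bi < m' <= b0) by (unfold m' in *; lra).
    assert (HKK : K m' + 1 <= K m).
    { replace (K m) with (2 * (b0 - m') / eta m + 1) by (unfold K, m'; field; lra).
      apply Rplus_le_compat_r. apply Hdiv; unfold m' in *; lra. }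
    assert (Haa : 2 * a m' + 1 <= a m).
    { unfold a. assert (H2 : 2 * exp (K m') <= exp (K m)); [|lra].
      apply Rle_trans with (exp (K m' + 1)).
      - rewrite exp_plus. assert (H := exp_ineq1 1 ltac:(lra)). assert (H' := exp_pos (K m')). nra.
      - destruct HKK as [HKK| ->]; [apply exp_increasing in HKK|]; lra. }
    assert (H1 := Hf1 s m' Hs Hm'2). assert (H2 := Ha0 m' Hm'2).
    assert (Hsp : 0 < s) by (destruct Hs as [|<-]; [assumption|]; lra).
    apply (Rmult_le_reg_r s); [assumption|]. unfold m' in *. nra.
Qed.

(** Growth of the trace in one Euler step, in units of tau mu^2 / d: n (10 n^2 + 1 + 4 c) for the
    pushed tensor by [push_bound], and a further n for the sphere. *)
Definition step_const (n : nat) (c : R) : R := INR n * (10 * INR n ^ 2 + 2 + 4 * c).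

(** The summands of [push] have orders mu^2, mu^2 / d and d mu^2; as d <= 1, all are bounded by
    multiples of mu^2 / d. *)
Lemma push_bound n c d T : 0 < d <= 1 -> 0 <= c ->
  tbound n (nrm n T ^ 2 / d * (10 * INR n ^ 2 + 1 + 4 * c))
    (push n c (nrm n T / d) (d * nrm n T ^ 2) T).
Proof.
  intros Hd Hc i j k l Hi Hj Hk Hl.
  assert (HTb := nrm_bound n T). assert (Hmu := nrm_nonneg n T). set (mu := nrm n T) in *.
  assert (H1 := Rabs_le_inv _ _ (Qc_bound n mu T HTb i j k l Hi Hj Hk Hl)).
  assert (Hmd : 0 <= mu / d) by (apply Rmult_le_pos; [assumption|apply Rlt_le, Rinv_0_lt_compat; lra]).
  assert (H2 := Rabs_le_inv _ _ (tbound_scal n (mu / d) mu T Hmd HTb i j k l Hi Hj Hk Hl)).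
  assert (Hdm : 0 <= d * mu ^ 2) by (apply Rmult_le_pos; [lra|apply pow2_ge_0]).
  assert (H3 := Rabs_le_inv _ _ (tbound_scal n _ _ _ Hdm (sphere_bound n c Hc) i j k l Hi Hj Hk Hl)).
  assert (Hm2 : mu ^ 2 <= mu ^ 2 / d).
  { rewrite <- (Rmult_1_r (mu ^ 2)) at 1. apply Rmult_le_compat_l; [apply pow2_ge_0|].
    rewrite <- Rinv_1. apply Rinv_le_contravar; lra. }
  assert (Hm3 : d * mu ^ 2 <= mu ^ 2) by (assert (H := pow2_ge_0 mu); nra).
  assert (Hn2 := pow2_ge_0 (INR n)).
  replace (mu / d * mu) with (mu ^ 2 / d) in H2 by (field; lra).
  assert (Ha : 10 * INR n ^ 2 * mu * mu <= mu ^ 2 / d * (10 * INR n ^ 2)) by nra.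
  assert (Hb : d * mu ^ 2 * (4 * c) <= mu ^ 2 / d * (4 * c)) by (apply Rmult_le_compat_r; lra).
  unfold push, tadd; unfold tscal in *. apply Rabs_le; lra.
Qed.

(** Let b = f h / h and let X be the pushed tensor in the cone of slope b. Adding the decompositions
    of (1 - r) T, tau X and ep P + E gives a trace h2 and the upper bound b h2 - ep n (b - bi),
    which has to lie under every line of the envelope at h2. The lower bound mu0 makes the gain ep,
    of order tau, beat the error A tau^2; the upper bound M bounds h, hence keeps b away from bi and
    d away from 0. *)
Lemma profile_step n theta c rho bi b0 g f a mu0 M A :
  (5 <= n)%nat -> 0 <= theta -> near_sphere n theta c rho -> bi = / (INR n - 2) -> bi < b0 ->
  (forall m, bi < m <= b0 -> 0 < g m <= 1 /\
     forall T b, m <= b <= b0 -> cone n theta b T -> 0 < nrm n T ->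
       cone n theta b (push n c (nrm n T / g m) (g m * nrm n T ^ 2) T)) ->
  (forall m m', bi < m -> m <= m' -> m' <= b0 -> g m <= g m') ->
  (forall m, bi < m <= b0 -> 0 <= a m) ->
  (forall s m, 0 <= s -> bi < m <= b0 -> f s <= a m + m * s) ->
  (forall s v, 0 <= s -> (forall m, bi < m <= b0 -> v <= a m + m * s) -> v <= f s) ->
  (forall s, 0 <= s -> f s <= b0 * s) ->
  (forall M, 0 < M -> exists b1, bi < b1 <= b0 /\ forall s, 0 <= s <= M -> b1 * s <= f s) ->
  (forall s b m, 0 <= s -> b <= b0 -> bi < m <= b0 -> f s = b * s ->
     f s + 1 <= a m + m * s \/ b <= m + g m ^ 2 * INR n * (m - bi) / step_const n c) ->
  0 < mu0 -> 0 < M -> 0 < A ->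
  exists del, 0 < del /\ forall T T1 tau, 0 < tau <= del ->
    mu0 <= nrm n T <= M -> is_act n T1 ->
    tclose n (A * tau ^ 2) T1 (tadd T (tscal tau (Qc n T))) ->
    set_f n f theta T -> set_f n f theta T1.
Proof.
  intros Hn5 Hth HN Hbi Hbb Hg Hgm Ha0 Hf1 Hf2 Hfb0 Hfb1 Hact Hmu0 HM HA.
  assert (HNn : 5 <= INR n) by (apply (le_INR 5) in Hn5; simpl in Hn5; lra).
  assert (Hc : 0 < c) by apply HN. assert (Hrho : 0 < rho) by apply HN.
  assert (Hbip : 0 < bi) by (rewrite Hbi; apply Rinv_0_lt_compat; lra).
  set (C4 := step_const n c) in *.
  assert (HC4 : 0 < C4) by (unfold C4, step_const; apply Rmult_lt_0_compat; nra).
  destruct (Hfb1 (INR n * M)) as (b1 & Hb1 & Hfb1'); [nra|].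
  set (d1 := g b1).
  destruct (Hg b1 Hb1) as [Hd1 _]. fold d1 in Hd1.
  assert (Hz1 : 0 < d1 * mu0 ^ 2 * rho) by (repeat apply Rmult_lt_0_compat; try apply pow_lt; lra).
  assert (Hz2 : 0 < M ^ 2 * b0 * C4) by (apply Rmult_lt_0_compat; [apply Rmult_lt_0_compat; [apply pow_lt|]|]; lra).
  (* The bounds ensure in turn that the error is absorbed, that r <= 1, and that the step stays
     below the lines lying at least 1 above f h. *)
  destruct (exists_small (cons (d1 * mu0 ^ 2 * rho / A) (cons (d1 / M) (cons (d1 / (M ^ 2 * b0 * C4)) nil))))
    as (del & Hdel & Hdl).
  { intros x [<-|[<-|[<-|[]]]]; apply Rdiv_lt_0_compat; lra. }
  assert (Hdl1 : del * A <= d1 * mu0 ^ 2 * rho).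
  { apply Rle_trans with (d1 * mu0 ^ 2 * rho / A * A); [|apply Req_le; field; lra].
    apply Rmult_le_compat_r; [lra|]. apply Hdl; simpl; auto. }
  assert (Hdl2 : del * M <= d1).
  { apply Rle_trans with (d1 / M * M); [|apply Req_le; field; lra].
    apply Rmult_le_compat_r; [lra|]. apply Hdl; simpl; auto. }
  assert (Hdl3 : del * (M ^ 2 * b0 * C4) <= d1).
  { apply Rle_trans with (d1 / (M ^ 2 * b0 * C4) * (M ^ 2 * b0 * C4)); [|apply Req_le; field; nra].
    apply Rmult_le_compat_r; [lra|]. apply Hdl; simpl; auto. }
  clear Hdl. exists del; split; [assumption|].
  intros T T1 tau Htau Hmu HT1 Hcl HT.
  apply set_f_splits in HT; destruct HT as [h Hh]. apply set_f_splits.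
  set (mu := nrm n T) in *.
  assert (HTb : tbound n mu T) by apply nrm_bound.
  assert (Hh0 := splits_trace_nonneg n theta _ _ _ Hth Hh).
  assert (HhM : h <= INR n * M).
  { eapply Rle_trans; [apply (splits_trace_bound n theta T h (f h) mu); auto|]. apply Rmult_le_compat_l; lra. }
  assert (Hb : exists b, b1 <= b <= b0 /\ f h = b * h).
  { assert (L1 := Hfb1' h ltac:(lra)). assert (L2 := Hfb0 h Hh0).
    destruct (Req_dec h 0) as [->|Hne].
    (* Here f 0 = 0, so any slope fits. *)
    - exists b0; split; [lra|]. lra.
    - exists (f h / h); split; [|field; lra].
      split; apply (Rmult_le_reg_r h); try lra; replace (f h / h * h) with (f h) by (field; lra); lra. }
  destruct Hb as (b & Hb & Hfh).
  destruct (Hg b ltac:(lra)) as [Hd Hpush]. assert (Hdd := Hgm b1 b ltac:(lra) ltac:(lra) ltac:(lra)).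
  fold d1 in Hdd. set (d := g b) in *.
  assert (HcT : cone n theta b T) by (exists h; rewrite <- Hfh; assumption).
  destruct (Hpush T b ltac:(lra) HcT) as [h' HX]; [fold mu; lra|]. fold mu in HX.
  set (X := push n c (mu / d) (d * mu ^ 2) T) in *.
  assert (Hh'0 := splits_trace_nonneg n theta _ _ _ Hth HX).
  assert (Hh' : h' <= INR n * (mu ^ 2 / d * (10 * INR n ^ 2 + 1 + 4 * c))).
  { apply (splits_trace_bound n theta X h' (b * h')); auto. apply push_bound; lra. }
  set (E := tadd T1 (tscal (-1) (tadd T (tscal tau (Qc n T))))).
  assert (HTact : is_act n T) by now apply (cone_act n theta b).
  assert (HE : is_act n E).
  { apply act_add; [assumption|]. apply act_scal, act_add; [assumption|]. now apply act_scal, Qc_act. }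
  assert (Hmu2 : mu0 ^ 2 <= mu ^ 2) by (apply pow_incr; lra).
  assert (Hmu2p : 0 < mu ^ 2) by (apply pow_lt; lra).
  set (ep := tau * (d * mu ^ 2)).
  assert (Hep : 0 < ep) by (unfold ep; repeat apply Rmult_lt_0_compat; lra).
  assert (HEb : tbound n (ep * rho) E).
  { intros i j k l Hi Hj Hk Hl.
    unfold E, tadd at 1, tscal at 1.
    match goal with |- Rabs (?x + -1 * ?y) <= _ => replace (x + -1 * y) with (x - y) by ring end.
    eapply Rle_trans; [apply Hcl; auto|].
    replace (A * tau ^ 2) with (tau * (tau * A)) by ring.
    replace (ep * rho) with (tau * (d * mu ^ 2 * rho)) by (unfold ep; ring).
    apply Rmult_le_compat_l; [lra|].
    apply Rle_trans with (del * A); [apply Rmult_le_compat_r; lra|].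
    eapply Rle_trans; [exact Hdl1|].
    apply Rmult_le_compat_r; [lra|]. apply Rmult_le_compat; try lra. apply pow2_ge_0. }
  assert (Hid : 0 < / d) by (apply Rinv_0_lt_compat; lra).
  set (r := tau * (mu / d)).
  assert (Hr : 0 <= r <= 1).
  { unfold r; split; [repeat apply Rmult_le_pos; lra|].
    apply (Rmult_le_reg_r d); [lra|]. replace (tau * (mu / d) * d) with (tau * mu) by (field; lra). nra. }
  assert (HS := splits_add _ _ _ _ _ _ _ _
     (splits_add _ _ _ _ _ _ _ _ (splits_scal n theta (1 - r) T h (f h) ltac:(lra) Hh)
                                  (splits_scal n theta tau X _ _ ltac:(lra) HX))
     (splits_near_sphere_scal n theta c rho ep E HN Hep HE HEb)).
  rewrite <- Hbi in HS.
  set (h2 := (1 - r) * h + tau * h' + ep * INR n) in HS.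
  exists h2.
  assert (Hh20 : 0 <= h2).
  { unfold h2; repeat apply Rplus_le_le_0_compat; repeat apply Rmult_le_pos; lra. }
  assert (Hmd : mu ^ 2 <= mu ^ 2 / d).
  { rewrite <- (Rmult_1_r (mu ^ 2)) at 1. apply Rmult_le_compat_l; [apply pow2_ge_0|].
    rewrite <- Rinv_1. apply Rinv_le_contravar; lra. }
  assert (Hh2 : h2 <= h + tau * (mu ^ 2 / d) * C4).
  { assert ((1 - r) * h <= h) by nra.
    assert (tau * h' <= tau * (INR n * (mu ^ 2 / d * (10 * INR n ^ 2 + 1 + 4 * c))))
      by (apply Rmult_le_compat_l; lra).
    assert (ep * INR n <= tau * (mu ^ 2 / d) * INR n).
    { apply Rmult_le_compat_r; [lra|]. unfold ep. apply Rmult_le_compat_l; [lra|].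
      apply Rle_trans with (mu ^ 2); [nra|assumption]. }
    unfold h2, C4, step_const. lra. }
  eapply splits_mono.
  2:{ eapply splits_ext; [|exact HS].
      intros i j k l _ _ _ _; unfold E, X, push, ep, r, tadd, tscal; ring. }
  apply Hf2; [assumption|]. intros m Hm.
  replace ((1 - r) * f h + tau * (b * h') + ep * (bi * INR n)) with (b * h2 - ep * INR n * (b - bi))
    by (rewrite Hfh; unfold h2; ring).
  assert (HepN : 0 <= ep * INR n * (b - bi)) by (repeat apply Rmult_le_pos; lra).
  assert (Ham := Ha0 m Hm).
  destruct (Rle_lt_dec b m) as [Hbm|Hbm]; [nra|].
  assert (Hx : (b - m) * h2 <= (b - m) * h + (b - m) * (tau * (mu ^ 2 / d) * C4)).
  { rewrite <- Rmult_plus_distr_l; apply Rmult_le_compat_l; lra. }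
  (* A line with a gap of 1 is not reached for small tau. For a closer line b - m <= eta m, and eta
     is chosen so that C4 eta m = (g m)^2 n (m - bi) <= d^2 n (b - bi); times tau mu^2 / d, the
     right side is the gain ep n (b - bi). *)
  destruct (Hact h b m Hh0 ltac:(lra) Hm Hfh) as [Hgap|Hnear].
  - assert ((b - m) * (tau * (mu ^ 2 / d) * C4) <= 1); [|lra].
    apply Rle_trans with (b0 * (tau * (M ^ 2 / d) * C4)).
    + assert (mu ^ 2 <= M ^ 2) by (apply pow_incr; lra).
      apply Rmult_le_compat; try lra.
      * apply Rmult_le_pos; [apply Rmult_le_pos; [|apply Rmult_le_pos]|]; lra.
      * apply Rmult_le_compat_r; [lra|]. apply Rmult_le_compat_l; [lra|]. apply Rmult_le_compat_r; lra.
    + apply (Rmult_le_reg_r d); [lra|].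
      replace (b0 * (tau * (M ^ 2 / d) * C4) * d) with (tau * (M ^ 2 * b0 * C4)) by (field; lra). nra.
  - assert (Hfm := Hf1 h m Hh0 Hm).
    assert ((b - m) * (tau * (mu ^ 2 / d) * C4) <= ep * INR n * (b - bi)); [|lra].
    assert (Hgmm := Hgm m b ltac:(lra) ltac:(lra) ltac:(lra)). fold d in Hgmm.
    destruct (Hg m Hm) as [Hgp _].
    assert (Hbm2 : (b - m) * C4 <= d ^ 2 * INR n * (b - bi)).
    { apply Rle_trans with (g m ^ 2 * INR n * (m - bi)).
      - apply Rle_trans with (g m ^ 2 * INR n * (m - bi) / C4 * C4); [|apply Req_le; field; lra].
        apply Rmult_le_compat_r; lra.
      - assert (g m ^ 2 <= d ^ 2) by (apply pow_incr; lra).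
        assert (0 <= g m ^ 2) by apply pow2_ge_0.
        apply Rmult_le_compat; try lra; [apply Rmult_le_pos; lra|apply Rmult_le_compat_r; lra]. }
    replace ((b - m) * (tau * (mu ^ 2 / d) * C4)) with (tau * (mu ^ 2 / d) * ((b - m) * C4)) by ring.
    replace (ep * INR n * (b - bi)) with (tau * (mu ^ 2 / d) * (d ^ 2 * INR n * (b - bi)))
      by (unfold ep; field; lra).
    apply Rmult_le_compat_l; [|assumption].
    apply Rmult_le_pos; [|apply Rmult_le_pos]; lra.
Qed.

Theorem theorem2p7 (n : nat) (theta_bar sigma0 theta : R) :
  (5 <= n)%nat -> is_theta_bar n theta_bar ->
  1 < sigma0 < 2 -> 0 < theta < theta_bar ->
  exists f : R -> R,
    (forall s, 0 <= s -> 0 <= f s) /\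
    (forall x y, 0 <= x -> x < y -> f x < f y) /\
    (forall x y l, 0 <= x -> 0 <= y -> 0 <= l <= 1 ->
        l * f x + (1 - l) * f y <= f (l * x + (1 - l) * y)) /\
    (exists d, 0 < d /\ forall s, 0 <= s < d -> f s = s / (INR n - 2 * sigma0)) /\
    (forall eps, 0 < eps -> exists M, forall s, M < s ->
        Rabs (f s / s - / (INR n - 2)) < eps) /\
    ode_invariant n (set_f n f theta).
Proof.
  intros Hn5 (Htb & Hinv & Htr) Hsig Hth.
  assert (HNn : 5 <= INR n) by (apply (le_INR 5) in Hn5; simpl in Hn5; lra).
  destruct (splits_near_sphere n theta Hn5 ltac:(lra)) as (c & rho & HN).
  change (near_sphere n theta c rho) in HN.
  assert (Hc : 0 < c) by apply HN.
  remember (/ (INR n - 2)) as bi eqn:Hbi. set (b0 := / (INR n - 2 * sigma0)).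
  assert (Hbip : 0 < bi) by (rewrite Hbi; apply Rinv_0_lt_compat; lra).
  assert (Hbb : bi < b0) by (rewrite Hbi; apply Rinv_lt_contravar; nra).
  assert (Hb04 : b0 < / (INR n - 4)) by (apply Rinv_lt_contravar; nra).
  destruct (monotone_choice bi b0 (fun m d => forall T b, m <= b <= b0 -> cone n theta b T ->
    0 < nrm n T -> cone n theta b (push n c (nrm n T / d) (d * nrm n T ^ 2) T))) as (g & Hg & Hgm).
  { intros m Hm.
    destruct (uniform_push n theta c rho m b0) as (d & Hd & H); auto; try lra.
    exists d; split; auto. }
  { intros m d d' Hm Hd H T b Hb HT Hmu.
    apply (cone_push_weaken n theta c rho b (nrm n T / d) (d * nrm n T ^ 2)); auto; try lra.
    - apply Rmult_le_compat_l; [lra|]. apply Rinv_le_contravar; lra.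
    - apply Rmult_lt_compat_r; [now apply pow_lt|lra]. }
  { intros m m' d _ Hmm H T b Hb; apply H; lra. }
  assert (HC4 : 0 < step_const n c) by (unfold step_const; apply Rmult_lt_0_compat; nra).
  destruct (concave_profile bi b0 (fun m => g m ^ 2 * INR n * (m - bi) / step_const n c))
    as (f & a & Ha0 & Hf1 & Hf2 & Hfb0 & (d0 & Hd0 & Hfd0) & Hfb1 & Hact); [lra| | |].
  { intros m Hm. destruct (Hg m Hm) as [Hgp _].
    apply Rdiv_lt_0_compat; [|assumption]. repeat apply Rmult_lt_0_compat; lra. }
  { intros m m' Hm Hmm Hm'. destruct (Hg m ltac:(lra)) as [Hgp _].
    assert (Hgg := Hgm m m' Hm Hmm Hm').
    apply Rmult_le_compat_r; [apply Rlt_le, Rinv_0_lt_compat; assumption|].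
    assert (g m ^ 2 <= g m' ^ 2) by (apply pow_incr; lra).
    assert (0 <= g m ^ 2) by apply pow2_ge_0.
    apply Rmult_le_compat; try lra; [apply Rmult_le_pos; lra|apply Rmult_le_compat_r; lra]. }
  assert (Hfbi : forall s, 0 <= s -> bi * s <= f s).
  { intros s Hs; apply Hf2; [assumption|]. intros m Hm. assert (H := Ha0 m Hm). nra. }
  exists f. split; [|split; [|split; [|split; [|split]]]].
  - intros s Hs; eapply Rle_trans; [|now apply Hfbi]. apply Rmult_le_pos; lra.
  - intros x y Hx Hxy.
    (* All lines have slope above bi > 0, so f grows at least at rate bi. *)
    assert (f x + bi * (y - x) <= f y); [|nra].
    apply Hf2; [lra|]. intros m Hm. assert (H := Hf1 x m Hx Hm). nra.
  - intros x y l Hx Hy Hl. apply Hf2; [nra|]. intros m Hm.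
    assert (H1 := Hf1 x m Hx Hm). assert (H2 := Hf1 y m Hy Hm).
    assert (l * f x <= l * (a m + m * x)) by (apply Rmult_le_compat_l; lra).
    assert ((1 - l) * f y <= (1 - l) * (a m + m * y)) by (apply Rmult_le_compat_l; lra).
    lra.
  - exists d0; split; [assumption|]. intros s Hs; rewrite Hfd0 by assumption.
    unfold b0; field; lra.
  - intros eps Heps.
    (* A single line of slope at most bi + eps/2 suffices, since its intercept is below (eps/2) s
       for large s. *)
    set (m := bi + Rmin (eps / 2) (b0 - bi)).
    assert (Hr1 := Rmin_l (eps / 2) (b0 - bi)). assert (Hr2 := Rmin_r (eps / 2) (b0 - bi)).
    assert (Hr3 : 0 < Rmin (eps / 2) (b0 - bi)) by (apply Rmin_pos; lra).
    assert (Hm : bi < m <= b0) by (unfold m; lra).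
    exists (2 * a m / eps). intros s Hs.
    assert (Ham := Ha0 m Hm).
    assert (0 <= 2 * a m / eps) by (apply Rmult_le_pos; [lra|apply Rlt_le, Rinv_0_lt_compat; lra]).
    assert (Hs0 : 0 < s) by lra.
    assert (Hams : a m < eps / 2 * s).
    { replace (a m) with (eps / 2 * (2 * a m / eps)) by (field; lra). apply Rmult_lt_compat_l; lra. }
    assert (H1 := Hf1 s m ltac:(lra) Hm). assert (H2 := Hfbi s ltac:(lra)).
    assert (H3 : m * s <= (bi + eps / 2) * s) by (apply Rmult_le_compat_r; unfold m; lra).
    replace (f s / s - bi) with ((f s - bi * s) / s) by (field; lra).
    unfold Rdiv; rewrite Rabs_mult, (Rabs_pos_eq (/ s)), Rabs_pos_eq by (try (apply Rlt_le, Rinv_0_lt_compat); lra).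
    apply (Rmult_lt_reg_r s); [assumption|].
    rewrite Rmult_assoc, Rinv_l, Rmult_1_r by lra. lra.
  - intros ta tb Rt Ht0 Hsol H0 T0 HT0.
    destruct (solution_bounded n ta tb Rt T0 Hsol ltac:(lra) HT0) as (M & HM & HRM).
    (* Since f s <= b0 s, the set lies in the cone of parameter sigma0. Invariance of that cone
       keeps the solution among the algebraic curvature tensors and settles the case of small
       norm. *)
    assert (Hcone : forall t, 0 <= t < tb -> cone n theta b0 (Rt t)).
    { intros t Ht. apply cone_C_splits; [lra|].
      apply (Hinv sigma0 theta ltac:(lra) ltac:(lra) ta tb Rt Ht0 Hsol); [|assumption].
      apply cone_C_splits; [lra|]. apply set_f_splits in H0; destruct H0 as [h Hh].
      exists h; eapply splits_mono; [|exact Hh]. apply Hfb0.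
      apply (splits_trace_nonneg n theta _ _ _ ltac:(lra) Hh). }
    (* Norm at most c1 gives h <= n c1 = d0/2, hence f h = b0 h. *)
    set (c1 := d0 / (2 * INR n)).
    assert (Hc1 : 0 < c1) by (apply Rdiv_lt_0_compat; lra).
    assert (HN4 : 0 < INR n ^ 4) by (apply pow_lt; lra).
    assert (HM3 : 0 < M ^ 3) by (apply pow_lt; lra).
    set (B := INR n ^ 4 * (10 * INR n ^ 2 * M * M)).
    assert (HB : 0 < B) by (unfold B; repeat apply Rmult_lt_0_compat; try apply pow_lt; lra).
    destruct (profile_step n theta c rho bi b0 g f a (c1 / 2) (INR n ^ 4 * M) (100 * INR n ^ 4 * M ^ 3))
      as (del1 & Hdel1 & Hstep); auto; try lra.
    { apply Rmult_lt_0_compat; lra. }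
    { repeat apply Rmult_lt_0_compat; lra. }
    destruct (exists_small (cons del1 (cons (c1 / 2 / B) nil))) as (del & Hdel & Hdl).
    { intros x [<-|[<-|[]]]; [assumption|apply Rdiv_lt_0_compat; lra]. }
    assert (Hdl1 : del <= del1) by (apply Hdl; simpl; auto).
    assert (Hdl2 : B * del <= c1 / 2).
    { apply Rle_trans with (B * (c1 / 2 / B)); [|apply Req_le; field; lra].
      apply Rmult_le_compat_l; [lra|]. apply Hdl; simpl; auto. }
    assert (Hadv : forall t tau, 0 <= t -> 0 < tau <= del -> t + tau <= T0 ->
              set_f n f theta (Rt t) -> set_f n f theta (Rt (t + tau))).
    { intros t tau Ht Htau Htt Hset.
      assert (Hbd : forall s, t <= s <= t + tau -> tbound n M (Rt s)) by (intros; apply HRM; lra).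
      (* The norm is tested at the end of the step: if it exceeds c1 there, the choice of del leaves
         at least c1/2 at the start, as [profile_step] requires. *)
      destruct (Rle_lt_dec (nrm n (Rt (t + tau))) c1) as [Hsmall|Hbig].
      - destruct (Hcone (t + tau) ltac:(lra)) as [h Hh].
        apply set_f_splits; exists h. rewrite Hfd0; [assumption|].
        split; [apply (splits_trace_nonneg n theta _ _ _ ltac:(lra) Hh)|].
        apply Rle_lt_trans with (INR n * c1).
        + apply (splits_trace_bound n theta (Rt (t + tau)) h (b0 * h)); auto.
          intros i j k l Hi Hj Hk Hl; eapply Rle_trans; [apply (nrm_bound n (Rt (t + tau)) i j k l Hi Hj Hk Hl)|assumption].
        + unfold c1. replace (INR n * (d0 / (2 * INR n))) with (d0 / 2) by (field; lra). lra.
      - apply (Hstep (Rt t) (Rt (t + tau)) tau); auto; try lra.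
        + assert (Hl := nrm_close n _ _ _ (solution_lipschitz n ta tb Rt M t tau Hsol ltac:(lra) ltac:(lra) ltac:(lra) Hbd)).
          split.
          * assert (B * tau <= B * del) by (apply Rmult_le_compat_l; lra). unfold B in *; lra.
          * apply nrm_le, Hbd; lra.
        + apply (cone_act n theta b0), Hcone; lra.
        + apply (solution_taylor n ta tb); auto; lra. }
    assert (Hiter : forall k s, 0 <= s <= T0 -> s <= INR k * del -> set_f n f theta (Rt s)).
    { induction k as [|k IH]; intros s Hs Hk.
      - simpl in Hk. replace s with 0 by lra. assumption.
      - rewrite S_INR in Hk.
        (* Only the step from time 0 may be shorter than del; all later ones have full length. *)
        destruct (Rle_lt_dec s del) as [Hsd|Hsd].
        + destruct (Req_dec s 0) as [->|Hs0]; [assumption|].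
          replace s with (0 + s) by ring. apply Hadv; auto; lra.
        + replace s with (s - del + del) by ring. apply Hadv; try lra. apply IH; lra. }
    destruct (INR_unbounded (T0 / del)) as [k Hk].
    apply (Hiter k); [lra|].
    apply Rle_trans with (T0 / del * del); [apply Req_le; field; lra|].
    apply Rmult_le_compat_r; lra.
Qed.
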